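(* Let $f$ be the map of one of the economic models (1)-(5) listed in the context, and suppose that $f$ has a mixing basic set $\Lambda$ on which $f$ is hyperbolic. Then the shift homeomorphism $\hat f:\hat\Lambda\to\hat\Lambda$ is expansive and has the specification property on the inverse limit $\hat\Lambda$.
   Context: Economic models; in each of them $f$ is a (in general non-invertible) map. (1) One-dimensional overlapping generations model: agents work when young and consume when old, maximizing $V_1(\ell_*-\ell_t)+V_2(c_{t+1})$ under the budget constraint $w_t\ell_t=p_{t+1}c_{t+1}$ ($\ell_t$ labour, $c_{t+1}$ future consumption, $\ell_*$ fixed labour endowment, $w_t$ wage, $p_{t+1}$ expected price). The solution is expressed by an offer curve, $\ell_t=\chi(c_{t+1})$, and since $\ell_t=c_t$ one gets $y_t=\chi(y_{t+1})$. Here $f=\chi$, an interval map, in many cases a smooth unimodal map (including the logistic maps $x\mapsto\nu x(1-x)$, $\nu>4$). (2) Two-dimensional overlapping generations model: with an offer curve $\chi$ as in (1), $a>0$ and $0<\delta<1$, the map is $f(z,w)=\left(\chi\left[a\left(1-\delta+\tfrac1a\right)z-aw\right],\,z\right)$, and the model is $(z_t,w_t)=f(z_{t+1},w_{t+1})$. (3) Cash-in-advance model: an agent maximizes $\sum_{t\ge0}\beta^tU(c_{1t},c_{2t})$, $\beta\in(0,1)$, $U(x,y)=\frac{x^{1-\sigma}}{1-\sigma}+\frac{y^{1-\gamma}}{1-\gamma}$, $\sigma,\gamma>0$, over $\{c_{1t},c_{2t},m_{t+1}\}_{t\ge0}$ subject to $p_tc_{1t}\le m_t$ and $m_{t+1}\le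 p_ty+(m_t-p_tc_{1t})+\theta M_t-p_tc_{2t}$, where $y$ is the endowment in each period, $c_{1t}+c_{2t}=y$, and the money supply satisfies $M_{t+1}=(1+\theta)M_t$. With $x_t=m_t/p_t$ the level of real money balance, one obtains a difference equation $x_t=f(x_{t+1})$ with a non-invertible one-variable map $f$; this is the map of the model. (4) Cobweb model with adaptive adjustment: $f(z)=f_{\alpha,\beta}(z)=(1-\alpha)z+\frac{\alpha}{z^\beta}$, $(\alpha,\beta)\in(0,1)\times(0,\infty)$, $z>0$. (5) Heterogeneous market model: $f(z,m)=\left(z\left[(1-\alpha)-\alpha\tfrac{b(1-m)}{2B}\right],\ \tanh\left[\tfrac{\beta b}{4}z^2\left(\tfrac{b(1-m)}{B}+1\right)+\tfrac\beta2(C_2-C_1)\right]\right)$ with real parameters $\alpha,\beta,b,B,C_1,C_2$. Mixing basic set. A compact set $\Lambda$ with $f(\Lambda)=\Lambda$ is basic for $f$ if there is an open neighbourhood $V$ of $\Lambda$ with $\Lambda=\bigcap_{n\in\mathbb{Z}}f^n(V)$ (for negative $n$, $f^n(V)$ denotes the preimage) and $f$ is topologically (forward) transitive on $\Lambda$; it is a mixing basic set if moreover $f$ is topologically mixing on $\Lambda$. Inverse limit. $\hat\Lambda=\{\hat x=(x,x_{-1},x_{-2},\ldots):\ x_{-i}\in\Lambda,\ f(x_{-i})=x_{-i+1},\ i\ge1\}$ (with $x_0=x$), $\hat f(x,x_{-1},\ldots)=(f(x),x,x_{-1},\ldots)$, metric $d(\hat x,\hat y)=\sum_{i\ge0}\frac{d(x_{-i},y_{-i})}{2^i}$.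 Hyperbolicity (in the endomorphism sense). $f$, smooth near $\Lambda$, is hyperbolic on $\Lambda$ if over $\hat\Lambda$ there is a continuous splitting of the tangent spaces $T_x=E^s_x\oplus E^u_{\hat x}$ with $Df(E^s_x)\subset E^s_{f(x)}$, $Df(E^u_{\hat x})=E^u_{\hat f\hat x}$, and constants $C>0$, $0<\lambda<1$ such that $|Df^n v|\le C\lambda^n|v|$ for $v\in E^s_x$ and $|Df^nv|\ge C^{-1}\lambda^{-n}|v|$ for $v\in E^u_{\hat x}$, $n\ge0$. The expanding case ($E^s=0$) is included. Expansiveness. A homeomorphism $T:X\to X$ of a metric space is expansive if there is $\delta_0>0$ such that $d(T^ix,T^iy)<\delta_0$ for all $i\in\mathbb{Z}$ implies $x=y$. Specification (for a homeomorphism $T:X\to X$ of a metric space). A specification $S=(\tau,P)$ consists of a finite collection $\tau=\{I_1,\ldots,I_m\}$ of finite intervals $I_i=[a_i,b_i]\subset\mathbb{Z}$ and a map $P:T(S)=\bigcup_{i=1}^mI_i\to X$ such that $T^{t_2-t_1}(P(t_1))=P(t_2)$ for all $t_1,t_2\in I_j\in\tau$. $S$ is $n$-spaced if $a_{i+1}>b_i+n$ for $1\le i<m$. Put $L(S)=b_m-a_1$. $S$ is $\varepsilon$-shadowed by $x\in X$ if $d(T^n(x),P(n))<\varepsilon$ for all $n\in T(S)$. $T$ has the specification property if for every $\varepsilon>0$ there is $M=M_\varepsilon\in\mathbb{N}$ such that every $M$-spaced specification $S$ is $\varepsilon$-shadowed by a point of $X$, and for every $q\ge M+L(S)$ there is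 a period-$q$ orbit (the orbit of a point $x$ with $T^qx=x$) $\varepsilon$-shadowing $S$. *)

(* Defs.v *)
From mathcomp Require Import all_boot all_order all_algebra.
From mathcomp Require Import all_classical all_reals all_analysis.

Set Implicit Arguments.
Unset Strict Implicit.
Unset Printing Implicit Defensive.

Import Order.TTheory GRing.Theory Num.Theory.
Import numFieldNormedType.Exports.

Local Open Scope classical_set_scope.
Local Open Scope ring_scope.

(* [fpow f n V] is f^n(V), a preimage when n < 0. *)
Definition fpow (E : Type) (f : E -> E) (n : int) (V : set E) : set E :=
  match n with
  | Posz k => iter k f @` V
  | Negz k => iter k.+1 f @^-1` V
  end.

Definition transitive_on (E : topologicalType) (f : E -> E) (L : set E) : Prop :=
  forall U W : set E, open U -> open W ->
    U `&` L !=set0 -> W `&` L !=set0 ->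
    exists2 n : nat, (0 < n)%N & (iter n f @` (U `&` L)) `&` (W `&` L) !=set0.

Definition mixing_on (E : topologicalType) (f : E -> E) (L : set E) : Prop :=
  forall U W : set E, open U -> open W ->
    U `&` L !=set0 -> W `&` L !=set0 ->
    exists N : nat, forall n : nat, (N <= n)%N ->
      (iter n f @` (U `&` L)) `&` (W `&` L) !=set0.

Definition basic_set (E : topologicalType) (f : E -> E) (L : set E) : Prop :=
  [/\ compact L,
      f @` L = L,
      exists V : set E,
        [/\ open V, L `<=` V & L = \bigcap_(n in [set: int]) fpow f n V]
    & transitive_on f L].

Definition mixing_basic_set (E : topologicalType) (f : E -> E) (L : set E) :
    Prop :=
  basic_set f L /\ mixing_on f L.

(* The prehistory (x, x_{-1}, x_{-2}, ...) is the sequence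
   xh : nat -> E with xh i = x_{-i}. *)
Definition inverse_limit (E : Type) (f : E -> E) (L : set E) : set (nat -> E) :=
  [set xh | forall i, L (xh i) /\ f (xh i.+1) = xh i].

Definition limit_shift (E : Type) (f : E -> E) (xh : nat -> E) : nat -> E :=
  fun i => if i is j.+1 then xh j else f (xh 0%N).

(* The inverse of [limit_shift f] on the inverse limit. *)
Definition limit_unshift (E : Type) (xh : nat -> E) : nat -> E := fun i => xh i.+1.

(* The series converges on [inverse_limit f L] when L is bounded. *)
Definition inv_dist (R : realType) (E : normedModType R) (xh yh : nat -> E) : R :=
  limn (fun n => \sum_(0 <= i < n) `|xh i - yh i| / 2 ^+ i).

Definition subspace_of (R : realType) (E : normedModType R) (A : set E) : Prop :=
  A 0 /\ forall (a : R) u v, A u -> A v -> A (a *: u + v).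

(* f is of class C^1 on a neighbourhood of L; as E is finite dimensional in all
   uses, continuity of Df may be tested on each vector v. *)
Definition smooth_near (R : realType) (E : normedModType R) (f : E -> E)
    (L : set E) : Prop :=
  exists U : set E, [/\ open U, L `<=` U &
    forall x, U x ->
      differentiable f x /\
      forall v : E, {for x, continuous (fun y : E => 'd f y v)}].

(* Every T_x is E.  T_x = Es x (+) Eu xh for x = xh 0, and the splitting is continuous: the
   projection pi xh onto Es x along Eu xh depends continuously on xh. *)
Definition continuous_splitting (R : realType) (E : normedModType R)
    (X : set (nat -> E)) (Es : E -> set E) (Eu : (nat -> E) -> set E) : Prop :=
  (forall xh, X xh ->
     [/\ subspace_of (Es (xh 0%N)), subspace_of (Eu xh)
       & Es (xh 0%N) `&` Eu xh = [set 0]]) /\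
  exists pi : (nat -> E) -> E -> E,
    (forall xh v, X xh -> Es (xh 0%N) (pi xh v) /\ Eu xh (v - pi xh v)) /\
    (forall xh v, X xh -> forall e : R, 0 < e -> exists2 r : R, 0 < r &
       forall yh, X yh -> inv_dist xh yh < r -> `|pi xh v - pi yh v| < e).

Definition hyperbolic (R : realType) (E : normedModType R) (f : E -> E)
    (L : set E) : Prop :=
  smooth_near f L /\
  exists (Es : E -> set E) (Eu : (nat -> E) -> set E),
    [/\ continuous_splitting (inverse_limit f L) Es Eu,
        forall x, L x -> 'd f x @` Es x `<=` Es (f x),
        forall xh, inverse_limit f L xh ->
          'd f (xh 0%N) @` Eu xh = Eu (limit_shift f xh)
      & exists C lambda : R, [/\ 0 < C, 0 < lambda < 1,
          forall x v n, L x -> Es x v ->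
            `|'d (iter n f) x v| <= C * lambda ^+ n * `|v|
        & forall xh v n, inverse_limit f L xh -> Eu xh v ->
            C^-1 * lambda ^- n * `|v| <= `|'d (iter n f) (xh 0%N) v|]].

(* The metric space is a subset X of a type S with
   a distance d; T' is the inverse of T on X. *)

Section Homeomorphisms.
Context {R : realType} {S : Type}.
Implicit Types (d : S -> S -> R) (X : set S) (T : S -> S).

Definition dist_continuous d X T : Prop :=
  forall x, X x -> forall e : R, 0 < e -> exists2 r : R, 0 < r &
    forall y, X y -> d x y < r -> d (T x) (T y) < e.

Definition homeomorphism d X T T' : Prop :=
  [/\ {homo T : x / X x >-> X x}, {homo T' : x / X x >-> X x},
      forall x, X x -> T' (T x) = x /\ T (T' x) = x,
      dist_continuous d X T & dist_continuous d X T'].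

Definition ziter T T' (n : int) : S -> S :=
  match n with
  | Posz k => iter k T
  | Negz k => iter k.+1 T'
  end.

Definition expansive d X T T' : Prop :=
  exists2 delta0 : R, 0 < delta0 &
    forall x y, X x -> X y ->
      (forall i : int, d (ziter T T' i x) (ziter T T' i y) < delta0) -> x = y.

(* The intervals are [a i, b i] for i < m, numbered from 0; only the values of
   P on their union [spec_times] matter. *)
Record specification X T T' := Specification {
  spec_m : nat;
  spec_a : nat -> int;
  spec_b : nat -> int;
  spec_P : int -> S;
  spec_m_gt0 : (0 < spec_m)%N;
  spec_ab : forall i, (i < spec_m)%N -> spec_a i <= spec_b i;
  spec_PX : forall i t, (i < spec_m)%N -> spec_a i <= t <= spec_b i ->
    X (spec_P t);
  spec_orbit : forall j t1 t2, (j < spec_m)%N ->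
    spec_a j <= t1 <= spec_b j -> spec_a j <= t2 <= spec_b j ->
    ziter T T' (t2 - t1) (spec_P t1) = spec_P t2
}.

Definition spec_times X T T' (s : specification X T T') : set int :=
  [set t | exists2 i, (i < spec_m s)%N & spec_a s i <= t <= spec_b s i].

Definition spec_length X T T' (s : specification X T T') : int :=
  spec_b s (spec_m s).-1 - spec_a s 0%N.

Definition spaced X T T' (n : nat) (s : specification X T T') : Prop :=
  forall i, (i.+1 < spec_m s)%N -> spec_b s i + n%:Z < spec_a s i.+1.

Definition shadowed d X T T' (e : R) (s : specification X T T') (x : S) : Prop :=
  forall n : int, spec_times s n -> d (ziter T T' n x) (spec_P s n) < e.

Definition specification_property d X T T' : Prop :=
  forall e : R, 0 < e -> exists M : nat,
    forall s : specification X T T', spaced M s ->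
      (exists2 x, X x & shadowed d e s x) /\
      (forall q : nat, M%:Z + spec_length s <= q%:Z ->
         exists x, [/\ X x, iter q T x = x & shadowed d e s x]).

End Homeomorphisms.

Definition olg_feasible (R : realType) (lstar w p l c : R) : Prop :=
  [/\ 0 <= l <= lstar, 0 <= c & w * l = p * c].

(* Utilities may take the value -oo, e.g. logarithmic utility at 0. *)
Definition olg_solution (R : realType) (V1 V2 : R -> \bar R)
    (lstar w p l c : R) : Prop :=
  olg_feasible lstar w p l c /\
  forall l' c', olg_feasible lstar w p l' c' ->
    (V1 (lstar - l')%R + V2 c' <= V1 (lstar - l)%R + V2 c)%E.

(* Over the interval J of future consumptions, the graph l = chi c consists
   exactly of the agents' optimal choices at all positive prices. *)
Definition offer_curve (R : realType) (V1 V2 : R -> \bar R) (lstar : R)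
    (J : set R) (chi : R -> R) : Prop :=
  [/\ forall x, (V1 x < +oo)%E /\ (V2 x < +oo)%E,
      is_interval J, J° !=set0
    & forall c l, J c ->
        (exists w p : R, [/\ 0 < w, 0 < p & olg_solution V1 V2 lstar w p l c])
        <-> l = chi c].

Definition olg2_arg (R : realType) (a delta : R) (zw : R * R) : R :=
  a * (1 - delta + a^-1) * zw.1 - a * zw.2.

Record cash_plan (R : realType) := CashPlan {
  cash_good : nat -> R;
  credit_good : nat -> R;
  money : nat -> R
}.

(* x^(1-s)/(1-s), read as usual as ln x when s = 1. *)
Definition crra (R : realType) (s x : R) : R :=
  if s == 1 then ln x else x `^ (1 - s) / (1 - s).

Definition cash_feasible (R : realType) (y theta : R) (p M : nat -> R)
    (k : cash_plan R) : Prop :=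
  money k 0%N = M 0%N /\
  forall t, [/\ 0 < cash_good k t, 0 < credit_good k t,
    p t * cash_good k t <= money k t
  & money k t.+1 <= p t * y + (money k t - p t * cash_good k t)
                    + theta * M t - p t * credit_good k t].

Definition cash_utility (R : realType) (beta sigma gamma : R)
    (k : cash_plan R) (n : nat) : \bar R :=
  (\sum_(0 <= t < n)
     beta ^+ t * (crra sigma (cash_good k t) + crra gamma (credit_good k t)))%:E.

Definition cash_optimal (R : realType) (beta sigma gamma y theta : R)
    (p M : nat -> R) (k : cash_plan R) : Prop :=
  [/\ cash_feasible y theta p M k,
      cvgn (cash_utility beta sigma gamma k),
      limn (cash_utility beta sigma gamma k) \is a fin_num
    & forall k', cash_feasible y theta p M k' ->
        cvgn (cash_utility beta sigma gamma k') ->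
        (limn (cash_utility beta sigma gamma k') <=
         limn (cash_utility beta sigma gamma k))%E].

Definition cash_equilibrium (R : realType) (beta sigma gamma y theta : R)
    (p M : nat -> R) (k : cash_plan R) : Prop :=
  [/\ forall t, 0 < p t,
      forall t, 0 < M t /\ M t.+1 = (1 + theta) * M t,
      forall t, cash_good k t + credit_good k t = y /\ money k t = M t
    & cash_optimal beta sigma gamma y theta p M k].

(* x_t = f (x_{t+1}) for the first-order conditions of an equilibrium: the cash
   good is c1 = min(x, cbar), where cbar is the unconstrained optimum, and
     x_t c2_t^(-gamma) = beta / (1 + theta) * x_{t+1} c1_{t+1}^(-sigma). *)
Definition cash_euler (R : realType) (beta sigma gamma y theta : R)
    (f : R -> R) : Prop :=
  exists cbar : R, [/\ 0 < cbar < y,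
    cbar `^ (- sigma) = (y - cbar) `^ (- gamma)
  & forall x, 0 < x ->
      f x * (y - Num.min (f x) cbar) `^ (- gamma) =
      beta / (1 + theta) * x * Num.min x cbar `^ (- sigma)].

(* The map f with x_t = f (x_{t+1}) for the real balances of every equilibrium.
   Equilibria need not visit every x > 0; the Euler equation, which is how the
   relation is derived, determines f on all of ]0, +oo[. *)
Definition cash_map (R : realType) (beta sigma gamma y theta : R)
    (f : R -> R) : Prop :=
  [/\ forall x, 0 < x -> 0 < f x,
      forall p M k, cash_equilibrium beta sigma gamma y theta p M k ->
        forall t, money k t / p t = f (money k t.+1 / p t.+1)
    & cash_euler beta sigma gamma y theta f].

Definition cobweb (R : realType) (alpha beta z : R) : R :=
  (1 - alpha) * z + alpha / z `^ beta.

Definition tanh (R : realType) (x : R) : R :=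
  (expR x - expR (- x)) / (expR x + expR (- x)).

Definition heterogeneous (R : realType) (alpha beta b B C1 C2 : R)
    (zm : R * R) : R * R :=
  let: (z, m) := zm in
  (z * ((1 - alpha) - alpha * (b * (1 - m) / (2 * B))),
   tanh (beta * b / 4 * z ^+ 2 * (b * (1 - m) / B + 1)
         + beta / 2 * (C2 - C1))).

Inductive economic_model (R : realType) : Type :=
| OLG1 (V1 V2 : R -> \bar R) (lstar : R) (J : set R) (chi : R -> R) of
    offer_curve V1 V2 lstar J chi
| OLG2 (V1 V2 : R -> \bar R) (lstar : R) (J : set R) (chi : R -> R)
    (a delta : R) of
    offer_curve V1 V2 lstar J chi & 0 < a & 0 < delta < 1
| CashInAdvance (beta sigma gamma y theta : R) (f : R -> R) of
    0 < beta < 1 & 0 < sigma & 0 < gamma & 0 < y & 0 < 1 + theta &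
    cash_map beta sigma gamma y theta f
| Cobweb (alpha beta : R) of 0 < alpha < 1 & 0 < beta
| HeterogeneousMarket (alpha beta b B C1 C2 : R) of B != 0.

Definition state_space (R : realType) (e : economic_model R) : normedModType R :=
  match e with
  | OLG1 _ _ _ _ _ _ | CashInAdvance _ _ _ _ _ _ _ _ _ _ _ _
  | Cobweb _ _ _ _ => R^o
  | OLG2 _ _ _ _ _ _ _ _ _ _ | HeterogeneousMarket _ _ _ _ _ _ _ =>
      (R^o * R^o)%type
  end.

Definition model_map (R : realType) (e : economic_model R) :
    state_space e -> state_space e :=
  match e return state_space e -> state_space e with
  | OLG1 _ _ _ _ chi _ => chi
  | OLG2 _ _ _ _ chi a delta _ _ _ =>
      fun zw : R * R => (chi (olg2_arg a delta zw), zw.1)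
  | CashInAdvance _ _ _ _ _ f _ _ _ _ _ _ => f
  | Cobweb alpha beta _ _ => cobweb alpha beta
  | HeterogeneousMarket alpha beta b B C1 C2 _ =>
      heterogeneous alpha beta b B C1 C2
  end.

(* The states at which the formula of the model is meaningful.  For an offer
   curve chi on J these are the arguments in the closure of J.  The logistic map
   nu * c * (1 - c), nu > 4, is an offer curve on J = ]0, 1[ (V1 x = x,
   V2 c = nu * (c - c^2 / 2), lstar = nu), but its invariant Cantor set contains
   0 and 1, and a neighbourhood of it leaves [0, 1]; hence chi is a function on
   R, unrestricted off the closure of J.  In the models on ]0, +oo[ the domain
   is open and f-invariant, so the isolating neighbourhood of a basic set may be
   taken in it and the values of f outside are immaterial. *)
Definition model_domain (R : realType) (e : economic_model R) :
    set (state_space e) :=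
  match e return set (state_space e) with
  | OLG1 _ _ _ J _ _ => closure J
  | OLG2 _ _ _ J _ a delta _ _ _ =>
      [set zw : R * R | closure J (olg2_arg a delta zw)]
  | CashInAdvance _ _ _ _ _ _ _ _ _ _ _ _ => [set x : R | 0 < x]
  | Cobweb _ _ _ _ => [set z : R | 0 < z]
  | HeterogeneousMarket _ _ _ _ _ _ _ => setT
  end.

Arguments inv_dist {R} E xh yh.
Arguments limit_unshift E xh : clear implicits.
Arguments model_map {R} e _.
Arguments model_domain {R} e _.

(* Main.v *)
From HB Require Import structures.
Require Import Defs.
From mathcomp Require Import all_boot all_order all_algebra.
From mathcomp Require Import all_classical all_reals all_analysis.
From mathcomp Require Import lra ring zify.

Set Implicit Arguments.
Unset Strict Implicit.
Unset Printing Implicit Defensive.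

Import Order.TTheory GRing.Theory Num.Theory.
Import numFieldNormedType.Exports.

Local Open Scope classical_set_scope.
Local Open Scope ring_scope.

(** Hyperbolicity gives a shadowing theorem with uniqueness for pseudo-orbits in
    the inverse limit; expansiveness and the specification property both follow
    from it.  The state space, a line or a plane, enters through a finite system
    of coordinates of norm at most 1 ([frame]).

    Shadowing.  Write C and lambda for the hyperbolicity constants, and replace f
    by g = f^N with N so large that mu = C lambda^N is small even after
    multiplication by a bound for the norms of the projections onto the stable
    spaces; compactness of the inverse limit provides that bound
    ([pi_bounded]).  As g contracts and expands in a
    single step, no adapted norm is needed.  Along a pseudo-orbit (x_t) of
    prehistories, a true orbit of g has the form x_t + v_t, where v is a fixed
    point of the transformation that pushes stable components forward and pulls
    unstable components back ([graph_transform_orbit]).  On bounded sequences v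
    this is a contraction of ratio 1/2 for the sup norm
    ([graph_transform_contr]), because g differs from its differential by a map
    with small Lipschitz constant, uniformly on Lambda
    ([iter_strict_differentiable]).  Hence the shadowing orbit exists and is
    unique ([iterate_shadowing]).

    Uniqueness is then used three times.  If z shadows the pseudo-orbit under g,
    then so does t |-> f (z_{t-1}), with a worse constant; so the two agree and z
    is an orbit of f ([orbit_shadowing]).  Two orbits that remain close shadow
    the same pseudo-orbit, which is expansiveness ([shift_expansive]).  A
    periodic pseudo-orbit is shadowed by a periodic orbit
    ([inverse_limit_shadowing]).  The isolating neighbourhood V keeps the
    shadowing orbit inside Lambda ([full_orbit_isolated]).

    Specification.  Mixing on Lambda lifts to the inverse limit, uniformly by
    compactness: any two points are joined, up to a given error, by orbit
    segments of every length beyond some N ([inverse_limit_mixing]).  Joining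
    consecutive blocks of a specification, and the last block to the first one
    after q steps, gives a pseudo-orbit of period q
    ([specification_periodic_pseudo_orbit]); the orbit that shadows it has period
    q.  Shadowing without prescribed period is the case of any large q. *)

(** * Finite coordinates and contractions of sequences *)

Lemma le0_of_le_half_pow (R : realType) (x A : R) :
  (forall n : nat, x <= A / 2 ^+ n) -> x <= 0.
Proof.
move=> h; rewrite leNgt; apply/negP => x0.
have A0 : 0 < A by apply: lt_le_trans x0 _; have := h 0%N; rewrite expr0 divr1.
have /archi_boundP := ltW (divr_gt0 A0 x0).
set n := Num.bound _ => hn.
have : A / x < 2 ^+ n.
  by apply: lt_trans hn _; rewrite -natrX ltr_nat ltn_expl.
rewrite ltr_pdivrMr // mulrC -ltr_pdivrMr ?exprn_gt0 // => hlt.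
by have := lt_le_trans hlt (h n); rewrite ltxx.
Qed.

Lemma half_powS (R : realType) (A : R) n : A / 2 ^+ n.+1 = A / 2 ^+ n / 2.
Proof. by rewrite exprS invfM mulrCA mulrC -mulrA mulrC. Qed.

(** Coordinates reduce completeness of E and the mean value inequality for maps
    of E to the real line. *)
Record frame (R : realType) (E : normedModType R) := Frame {
  frame_dim : nat;
  frame_vec : 'I_frame_dim -> E;
  frame_coord : 'I_frame_dim -> {linear E -> R^o};
  frame_coord_le : forall i v, `|frame_coord i v| <= `|v|;
  frame_expand : forall v, v = \sum_i frame_coord i v *: frame_vec i
}.

Arguments frame_vec {R E} f i.
Arguments frame_coord {R E} f i.

(** The sequence x n - 2 C / 2^n increases, x n + 2 C / 2^n decreases, and the
    limit is the supremum of the former, which lies below the latter. *)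
Lemma real_geometric_cauchy (R : realType) (x : nat -> R) (C : R) :
  (forall n, `|x n.+1 - x n| <= C / 2 ^+ n) ->
  exists l, forall n, `|x n - l| <= 2 * C / 2 ^+ n.
Proof.
move=> hx.
pose y n := x n - 2 * C / 2 ^+ n; pose z n := x n + 2 * C / 2 ^+ n.
have C0 : 0 <= C by have := le_trans (normr_ge0 _) (hx 0%N); rewrite expr0 divr1.
have yS n : y n <= y n.+1.
  have := hx n; rewrite /y half_powS ler_norml => /andP[h _].
  by rewrite -!mulrA; lra.
have zS n : z n.+1 <= z n.
  have := hx n; rewrite /z half_powS ler_norml => /andP[_ h].
  by rewrite -!mulrA; lra.
have yM : {homo y : m n / (m <= n)%N >-> m <= n}.
  by apply: homo_leq => //; apply: le_trans.
have zM : {homo z : m n / (m <= n)%N >-> n <= m}.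
  by apply: homo_leq => // b a c h1 h2; apply: le_trans h2 h1.
have yz n : y n <= z n.
  by rewrite /y /z lerD2l ge0_cp ?divr_ge0 ?mulr_ge0.
have yzz m n : y m <= z n.
  by apply: le_trans (yM _ _ (leq_maxl m n)) (le_trans (yz _) (zM _ _ (leq_maxr m n))).
have hs : has_sup (range y).
  split; first by exists (y 0%N), 0%N.
  by exists (z 0%N) => _ [m _ <-].
exists (sup (range y)) => n.
have h1 : y n <= sup (range y).
  by apply: sup_upper_bound hs _ _; exists n.
have h2 : sup (range y) <= z n.
  by apply: ge_sup; [case: hs | move=> _ [m _ <-]].
rewrite /y /z in h1 h2 *; rewrite ler_norml; apply/andP; split; lra.
Qed.

Section Frames.
Context (R : realType) (E : normedModType R) (F : frame E).

Lemma frame_geometric_cauchy : exists2 K : R, 0 <= K &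
  forall (u : nat -> E) (C : R), (forall n, `|u n.+1 - u n| <= C / 2 ^+ n) ->
  exists l, forall n, `|u n - l| <= K * C / 2 ^+ n.
Proof.
exists (\sum_i 2 * `|frame_vec F i|); first by apply: sumr_ge0 => i _; rewrite mulr_ge0.
move=> u C hu.
have h i : exists l : R, forall n, `|frame_coord F i (u n) - l| <= 2 * C / 2 ^+ n.
  apply: real_geometric_cauchy => n; apply: le_trans (hu n).
  by rewrite -linearB; apply: frame_coord_le.
have [l hl] := choice h.
exists (\sum_i l i *: frame_vec F i) => n.
rewrite {1}(frame_expand F (u n)) -sumrB -(mulrA _ C) mulr_suml.
apply: le_trans (ler_norm_sum _ _ _) _; apply: ler_sum => i _.
rewrite -scalerBl normrZ.
have -> : 2 * `|frame_vec F i| * (C / 2 ^+ n) = 2 * C / 2 ^+ n * `|frame_vec F i| by ring.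
exact: ler_wpM2r.
Qed.

Lemma frame_linear_bound (L : E -> E) (a : R) :
  linear L -> (forall i, `|L (frame_vec F i)| <= a) ->
  forall v, `|L v| <= (frame_dim F)%:R * a * `|v|.
Proof.
move=> linL hL v.
pose L' : {linear E -> E} := HB.pack L (GRing.isLinear.Build _ _ _ _ L linL).
rewrite -[L v]/(L' v) {1}(frame_expand F v) linear_sum.
apply: le_trans (ler_norm_sum _ _ _) _.
have -> : (frame_dim F)%:R * a * `|v| = \sum_(i < frame_dim F) `|v| * a.
  by rewrite sumr_const card_ord -[RHS]mulr_natl; ring.
by apply: ler_sum => i _; rewrite linearZ normrZ ler_pM ?frame_coord_le //; apply: hL.
Qed.

Lemma frame_norm_bound (v : E) (a : R) :
  (forall i, `|frame_coord F i v| <= a) -> `|v| <= (\sum_i `|frame_vec F i|) * a.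
Proof.
move=> hv; rewrite {1}(frame_expand F v) mulr_suml.
apply: le_trans (ler_norm_sum _ _ _) _; apply: ler_sum => i _.
by rewrite normrZ mulrC ler_wpM2l.
Qed.

Section SupContraction.
Context (I : Type) (Phi : (I -> E) -> I -> E) (rho : R).
Hypothesis Phi_contr : forall u v c,
  (forall i, `|u i| <= rho) -> (forall i, `|v i| <= rho) ->
  (forall i, `|u i - v i| <= c) -> forall i, `|Phi u i - Phi v i| <= c / 2.

Lemma sup_contraction_unique u v :
  (forall i, `|u i| <= rho) -> (forall i, `|v i| <= rho) ->
  Phi u =1 u -> Phi v =1 v -> u =1 v.
Proof.
move=> hu hv fu fv i.
have h n : forall i, `|u i - v i| <= 2 * rho / 2 ^+ n.
  elim: n => [|n IH] j.
    rewrite expr0 divr1; apply: le_trans (ler_normB _ _) _.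
    by have := hu j; have := hv j; lra.
  by rewrite half_powS -fu -fv; apply: Phi_contr.
have := @le0_of_le_half_pow R _ _ (fun n => h n i).
by rewrite normr_le0 subr_eq0 => /eqP.
Qed.

(** The Banach fixed point theorem on the ball of radius rho of the sup norm on
    families indexed by I.  The iterates from 0 converge geometrically at a rate
    independent of the index, so their pointwise limit is a uniform one. *)
Lemma sup_contraction_fixpoint :
  (forall i, `|Phi (fun=> 0) i| <= rho / 2) ->
  exists2 v, forall i, `|v i| <= rho & Phi v =1 v.
Proof.
move=> h0; pose w n := iter n Phi (fun=> 0).
case: (pselect (inhabited I)) => [[i0]|noI]; last first.
  by exists (fun=> 0) => i; exfalso; apply: noI.
have rho0 : 0 <= rho by have := le_trans (normr_ge0 _) (h0 i0); lra.
have hw n : (forall i, `|w n i| <= rho) /\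
            (forall i, `|w n.+1 i - w n i| <= rho / 2 / 2 ^+ n).
  elim: n => [|n [IH1 IH2]].
    by split=> i; rewrite /w /= ?normr0 // expr0 divr1 subr0; apply: h0.
  have h1 i : `|w n.+1 i| <= rho.
    have -> : w n.+1 i = Phi (fun=> 0) i + (Phi (w n) i - Phi (fun=> 0) i).
      by rewrite addrC subrK.
    apply: le_trans (ler_normD _ _) _.
    have -> : rho = rho / 2 + rho / 2 by lra.
    apply: lerD => //; apply: Phi_contr => // j; first by rewrite normr0.
    by rewrite subr0.
  split => // i; rewrite half_powS; exact: Phi_contr.
have [K K0 hK] := frame_geometric_cauchy.
have hl i : exists l, forall n, `|w n i - l| <= K * (rho / 2) / 2 ^+ n.
  by apply: hK => n; case: (hw n).
have [v hv] := choice hl.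
have vrho i : `|v i| <= rho.
  rewrite -subr_le0; apply: (@le0_of_le_half_pow R _ (K * (rho / 2))) => n.
  have : `|v i| <= `|w n i| + `|w n i - v i|.
    by rewrite -[X in `|X|](subKr (w n i)) ler_normB.
  have := (hw n).1 i; have := hv i n; lra.
exists v => // i.
apply/eqP; rewrite -subr_eq0 -normr_le0.
apply: (@le0_of_le_half_pow R _ (K * (rho / 2))) => n.
have -> : Phi v i - v i = (Phi v i - w n.+1 i) + (w n.+1 i - v i).
  by rewrite addrA subrK.
apply: le_trans (ler_normD _ _) _.
have h1 : `|Phi v i - w n.+1 i| <= K * (rho / 2) / 2 ^+ n / 2.
  by apply: Phi_contr (hw n).1 _ i => // j; rewrite distrC.
have := hv i n.+1; rewrite half_powS; lra.
Qed.

End SupContraction.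
End Frames.

(** * Hyperbolic sequences of maps *)

Lemma subrACA (V : zmodType) (a b c d : V) :
  a - b - (c - d) = a - c - (b - d).
Proof. by rewrite !opprD addrACA. Qed.

Lemma small_mul_le1 (R : realType) (mu K : R) :
  0 <= mu -> 0 <= K -> mu * (3 * K + 2) <= 1 / 4 -> mu * (1 + K) <= 1.
Proof. by move=> mu0 K0 h; have := mulr_ge0 mu0 K0; nra. Qed.

(** Maps G k from a neighbourhood of 0 in the fibre of k to the fibre of [next k],
    close to linear maps D k.  P k is the projection onto the stable space of k.
    D k respects the splittings given by P k at its source and by Q k at its
    target; Q k is merely close to P (next k), which is the effect of the jump of
    a pseudo-orbit.  The question is which bounded sequences v satisfy
    G k (v k) = v (next k). *)
Section HyperbolicSequence.
Context (R : realType) (E : normedModType R) (F : frame E).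
Context (I : Type) (next prev : I -> I).
Hypotheses (nextK : cancel next prev) (prevK : cancel prev next).
Context (P Q D G : I -> E -> E) (K M mu eta rho : R).
Hypotheses (PB : forall k, {morph P k : u v / u - v})
  (QB : forall k, {morph Q k : u v / u - v})
  (DB : forall k, {morph D k : u v / u - v}).
Hypotheses (PP : forall k v, P k (P k v) = P k v)
  (PK : forall k v, `|P k v| <= K * `|v|)
  (QK : forall k v, `|Q k v| <= K * `|v|)
  (PQ : forall k v, `|P (next k) v - Q k v| <= eta * `|v|)
  (DM : forall k v, `|D k v| <= M * `|v|)
  (QD : forall k v, Q k (D k v) = D k (P k v))
  (Dstable : forall k v, `|D k (P k v)| <= mu * `|P k v|)
  (Dunstable : forall k v, P k v = 0 -> `|v| <= mu * `|D k v|)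
  (Dsurj : forall k w, exists v, P k v = 0 /\ D k v = w - Q k w)
  (Glip : forall k u v, `|u| <= rho -> `|v| <= rho ->
     `|G k u - G k v - D k (u - v)| <= eta * `|u - v|).
Hypotheses (K0 : 0 <= K) (M0 : 0 <= M) (mu0 : 0 <= mu) (eta01 : 0 <= eta < 1)
  (mu_small : mu * (3 * K + 2) <= 1 / 4) (eta_small : eta * (M + K) <= 1 / 4).

Let mor0 (h : E -> E) : {morph h : u v / u - v} -> h 0 = 0.
Proof. by move=> hB; have := hB 0 0; rewrite !subrr. Qed.

Let morD (h : E -> E) : {morph h : u v / u - v} -> {morph h : u v / u + v}.
Proof.
move=> hB u v; have hN w : h (- w) = - h w by rewrite -sub0r hB (mor0 hB) sub0r.
by rewrite -{1}[v]opprK hB hN opprK.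
Qed.

(** B k applies the inverse of D k, from unstable space to unstable space, to the
    unstable component of its argument. *)
Lemma unstable_inverse : exists B : I -> E -> E,
  [/\ forall k w, P k (B k w) = 0, forall k w, D k (B k w) = w - Q k w,
      forall k w w', `|B k w - B k w'| <= mu * (1 + K) * `|w - w'|
    & forall k v, B k (D k v) = v - P k v].
Proof.
pose B k := projT1 (choice (Dsurj k)).
have hB k w : P k (B k w) = 0 /\ D k (B k w) = w - Q k w.
  exact: (projT2 (choice (Dsurj k)) w).
exists B; split => [k w|k w|k w w'|k v]; try by case: (hB k w).
- have h : P k (B k w - B k w') = 0.
    by rewrite PB (hB k w).1 (hB k w').1 subrr.
  apply: le_trans (Dunstable h) _; rewrite -mulrA; apply: ler_wpM2l => //.
  rewrite DB (hB k w).2 (hB k w').2.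
  have -> : w - Q k w - (w' - Q k w') = (w - w') - Q k (w - w').
    by rewrite QB subrACA.
  apply: le_trans (ler_normB _ _) _; rewrite mulrDl mul1r; exact: lerD.
- set v' := v - P k v.
  have pv' : P k v' = 0 by rewrite PB PP subrr.
  have h : P k (B k (D k v) - v') = 0 by rewrite PB (hB _ _).1 pv' subrr.
  have := Dunstable h; rewrite DB (hB _ _).2 [D k v']DB QD subrr normr0 mulr0.
  by rewrite normr_le0 subr_eq0 => /eqP.
Qed.

(** The stable component of the new v k is pushed forward from [prev k]; its
    unstable component solves the linearised equation backwards from [next k]. *)
Definition graph_transform (B : I -> E -> E) (v : I -> E) (k : I) : E :=
  P k (G (prev k) (v (prev k))) + B k (v (next k) - (G k (v k) - D k (v k))).

Section Transform.
Context (B : I -> E -> E).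
Hypotheses (PB0 : forall k w, P k (B k w) = 0)
  (DBE : forall k w, D k (B k w) = w - Q k w)
  (Blip : forall k w w', `|B k w - B k w'| <= mu * (1 + K) * `|w - w'|)
  (BD : forall k v, B k (D k v) = v - P k v).

Lemma graph_transform_contr u v c :
  (forall i, `|u i| <= rho) -> (forall i, `|v i| <= rho) ->
  (forall i, `|u i - v i| <= c) ->
  forall i, `|graph_transform B u i - graph_transform B v i| <= c / 2.
Proof.
move=> hu hv huv k; have c0 : 0 <= c by apply: le_trans (huv k).
have /andP[eta0 eta1] := eta01.
rewrite /graph_transform; set bu := B k _; set bv := B k _.
rewrite opprD addrACA.
apply: le_trans (ler_normD _ _) _.
set j := prev k; set z := u j - v j.
have hz : `|z| <= c by apply: huv.
have h1 : `|P k (G j (u j)) - P k (G j (v j))| <= (mu * K + eta * (M + K)) * c.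
  set r := G j (u j) - G j (v j) - D j z.
  have hr : `|r| <= eta * `|z| by apply: Glip.
  have -> : P k (G j (u j)) - P k (G j (v j)) =
            (P k (D j z) - Q j (D j z)) + D j (P j z) + P k r.
    by rewrite -PB -QD subrK /r [X in _ = _ + X]PB [RHS]addrC subrK.
  apply: le_trans (ler_normD _ _) _.
  have -> : (mu * K + eta * (M + K)) * c = (eta * (M * c) + mu * (K * c)) + K * (eta * c).
    by ring.
  apply: lerD.
    apply: le_trans (ler_normD _ _) _; apply: lerD.
      have := PQ j (D j z); rewrite prevK => h; apply: le_trans h _.
      apply: ler_wpM2l => //; apply: le_trans (DM _ _) _.
      exact: ler_wpM2l.
    apply: le_trans (Dstable _ _) _; apply: ler_wpM2l => //.
    by apply: le_trans (PK _ _) _; apply: ler_wpM2l.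
  apply: le_trans (PK _ _) _; apply: ler_wpM2l => //.
  by apply: le_trans hr _; apply: ler_wpM2l.
have h2 : `|B k (u (next k) - (G k (u k) - D k (u k))) -
            B k (v (next k) - (G k (v k) - D k (v k)))| <= mu * (1 + K) * (2 * c).
  apply: le_trans (Blip _ _ _) _; apply: ler_wpM2l; first by rewrite mulr_ge0 ?addr_ge0.
  have -> : u (next k) - (G k (u k) - D k (u k)) - (v (next k) - (G k (v k) - D k (v k)))
    = (u (next k) - v (next k)) - (G k (u k) - G k (v k) - D k (u k - v k)).
    by rewrite DB subrACA [in LHS](subrACA (G k (u k))).
  apply: le_trans (ler_normB _ _) _.
  have := huv (next k); have := Glip k (hu k) (hv k).
  have := huv k; have := ler_piMl (normr_ge0 (u k - v k)) (ltW eta1); lra.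
apply: le_trans (lerD h1 h2) _.
have -> : (mu * K + eta * (M + K)) * c + mu * (1 + K) * (2 * c) =
          (mu * (3 * K + 2) + eta * (M + K)) * c by ring.
have -> : c / 2 = (1 / 4 + 1 / 4) * c by field.
by apply: ler_wpM2r => //; apply: lerD.
Qed.

(** For a fixed point, the defect w = v (next k) - G k (v k) has no component
    along P (next k) and none along 1 - Q k.  So w = Q k w - P (next k) w, of
    norm at most eta |w| with eta < 1, and w = 0. *)
Lemma graph_transform_orbit v :
  graph_transform B v =1 v <-> forall k, G k (v k) = v (next k).
Proof.
have /andP[eta0 eta1] := eta01.
split=> hv k.
- set w := v (next k) - G k (v k).
  have Pw : P (next k) w = 0.
    rewrite PB -{1}(hv (next k)) /graph_transform nextK.
    set b := B _ _; set g := P _ (G _ _).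
    by rewrite (morD (PB _)) PB0 addr0 PP subrr.
  have Qw : w - Q k w = 0.
    have : D k (v k - P k (v k)) =
           D k (B k (v (next k) - (G k (v k) - D k (v k)))).
      rewrite -{1}(hv k) /graph_transform.
      set b := B _ _; set g := P _ _.
      have Pv : P k (v k) = g.
        rewrite -(hv k) /graph_transform -/b -/g.
        by rewrite (morD (PB _)) PB0 addr0 PP.
      by rewrite Pv [g + b]addrC addrK.
    rewrite DBE DB -QD.
    have -> : v (next k) - (G k (v k) - D k (v k)) = w + D k (v k).
      by rewrite opprB addrA addrAC.
    rewrite (morD (QB k)) opprD addrACA => /eqP.
    by rewrite -subr_eq0 opprD addrCA subrr addr0 oppr_eq0 => /eqP.
  have hw : `|w| <= eta * `|w|.
    have := PQ k w; rewrite Pw sub0r normrN.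
    by move/eqP: Qw; rewrite subr_eq0 => /eqP <-.
  have : w = 0 by apply/eqP; rewrite -normr_le0; have := normr_ge0 w; nra.
  by move/eqP; rewrite subr_eq0 => /eqP.
- rewrite /graph_transform hv prevK.
  have -> : v (next k) - (G k (v k) - D k (v k)) = D k (v k).
    by rewrite hv opprB addrC subrK.
  by rewrite BD addrC subrK.
Qed.

End Transform.

Lemma hyperbolic_orbit_unique u v :
  (forall i, `|u i| <= rho) -> (forall i, `|v i| <= rho) ->
  (forall k, G k (u k) = u (next k)) -> (forall k, G k (v k) = v (next k)) ->
  u =1 v.
Proof.
have [B [h1 h2 h3 h4]] := unstable_inverse.
move=> hu hv /(graph_transform_orbit h1 h2 h4) fu.
move=> /(graph_transform_orbit h1 h2 h4) fv.
exact: sup_contraction_unique (graph_transform_contr h3) _ _ hu hv fu fv.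
Qed.

Lemma hyperbolic_orbit_exists delta :
  (forall k, `|G k 0| <= delta) -> (K + 1) * delta <= rho / 2 ->
  exists2 v, forall i, `|v i| <= rho & forall k, G k (v k) = v (next k).
Proof.
move=> hd hrho.
have [B [h1 h2 h3 h4]] := unstable_inverse.
have [v hv fv] : exists2 v, forall i, `|v i| <= rho & graph_transform B v =1 v.
  apply: sup_contraction_fixpoint => //; first exact: graph_transform_contr.
  move=> k; apply: le_trans hrho; rewrite /graph_transform.
  have d0 : 0 <= delta by apply: le_trans (hd k).
  apply: le_trans (ler_normD _ _) _.
  have e1 : `|P k (G (prev k) 0)| <= K * delta.
    by apply: le_trans (PK _ _) _; apply: ler_wpM2l.
  have B0 : B k 0 = 0 by rewrite -{1}(mor0 (DB k)) h4 (mor0 (PB k)) subrr.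
  have e2 : `|B k (0 - (G k 0 - D k 0))| <= mu * (1 + K) * delta.
    have := h3 k (0 - (G k 0 - D k 0)) 0.
    rewrite B0 !subr0 (mor0 (DB k)) subr0 sub0r normrN => /le_trans; apply.
    by apply: ler_wpM2l; rewrite // mulr_ge0 ?addr_ge0.
  have h := small_mul_le1 mu0 K0 mu_small.
  have := ler_piMl d0 h; lra.
by exists v => //; apply/(graph_transform_orbit h1 h2 h4).
Qed.

End HyperbolicSequence.

(** * The metric of the inverse limit *)

Section InvDist.
Context (R : realType) (E : normedModType R) (Bd : R).
Implicit Types x y z : nat -> E.
Let bounded x := forall i, `|x i| <= Bd.

Let partial x y n := \sum_(0 <= i < n) `|x i - y i| / 2 ^+ i.

Lemma geometric_sum_le (c : R) n : 0 <= c ->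
  \sum_(0 <= i < n) c * (3 / 4) ^+ i <= 4 * c.
Proof.
move=> c0; suff -> : \sum_(0 <= i < n) c * (3 / 4) ^+ i = 4 * c * (1 - (3 / 4) ^+ n).
  by rewrite ler_piMr ?mulr_ge0 // lerBlDr lerDl exprn_ge0.
elim: n => [|n IH]; first by rewrite big_geq // expr0 subrr mulr0.
by rewrite big_nat_recr //= IH exprS; field.
Qed.

Let partial_homo x y : {homo partial x y : m n / (m <= n)%N >-> m <= n}.
Proof.
apply: homo_leq => // [|n]; first exact: le_trans.
by rewrite /partial big_nat_recr //= lerDl divr_ge0 ?exprn_ge0.
Qed.

Let partial_le x y c : 0 <= c ->
  (forall i, `|x i - y i| / 2 ^+ i <= c * (3 / 4) ^+ i) ->
  forall n, partial x y n <= 4 * c.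
Proof.
move=> c0 h n; apply: le_trans (geometric_sum_le n c0).
by apply: ler_sum => i _.
Qed.

Lemma tail_term_le x y i : bounded x -> bounded y ->
  `|x i - y i| / 2 ^+ i <= 2 * Bd * (2 / 3) ^+ i * (3 / 4) ^+ i.
Proof.
move=> hx hy.
have -> : 2 * Bd * (2 / 3) ^+ i * (3 / 4) ^+ i = 2 * Bd / 2 ^+ i.
  rewrite -mulrA -exprMn; congr (_ * _).
  have -> : 2 / 3 * (3 / 4) = 2^-1 :> R by field.
  by rewrite exprVn.
rewrite ler_wpM2r ?invr_ge0 ?exprn_ge0 //.
by apply: le_trans (ler_normB _ _) _; have := hx i; have := hy i; lra.
Qed.

Let partial_cvg x y : bounded x -> bounded y -> cvgn (partial x y).
Proof.
move=> hx hy; apply: nondecreasing_is_cvgn; first exact: partial_homo.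
have Bd0 : 0 <= Bd by apply: le_trans (hx 0%N).
exists (4 * (2 * Bd)) => _ [n _ <-]; apply: partial_le => [|i]; first by rewrite mulr_ge0.
apply: le_trans (tail_term_le i hx hy) _; rewrite ler_wpM2r ?exprn_ge0 //.
by rewrite ler_piMr ?mulr_ge0 // exprn_ile1 //; lra.
Qed.

(** Comparison with a series of ratio 3/4, not 1/2, leaves the factor (2/3)^i to
    make the tails of bounded sequences small. *)
Lemma inv_dist_le x y c : bounded x -> bounded y -> 0 <= c ->
  (forall i, `|x i - y i| / 2 ^+ i <= c * (3 / 4) ^+ i) ->
  inv_dist E x y <= 4 * c.
Proof.
move=> hx hy c0 h; apply: limr_le; first exact: partial_cvg.
by apply: nearW => n; apply: partial_le.
Qed.

Lemma inv_dist_coord x y i : bounded x -> bounded y ->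
  `|x i - y i| <= 2 ^+ i * inv_dist E x y.
Proof.
move=> hx hy; rewrite mulrC -ler_pdivrMr ?exprn_gt0 //.
have : partial x y i.+1 <= inv_dist E x y.
  by apply: nondecreasing_cvgn_le; [exact: partial_homo | exact: partial_cvg].
apply: le_trans; rewrite /partial big_nat_recr //= lerDr.
by apply: sumr_ge0 => k _; rewrite divr_ge0 ?exprn_ge0.
Qed.

Lemma inv_dist_triangle x y z : bounded x -> bounded y -> bounded z ->
  inv_dist E x z <= inv_dist E x y + inv_dist E y z.
Proof.
move=> hx hy hz.
have cxy := partial_cvg hx hy; have cyz := partial_cvg hy hz.
rewrite /inv_dist -[X in _ <= X]limD //.
apply: ler_lim; [exact: partial_cvg | exact: is_cvgD |].
apply: nearW => n; rewrite -[X in _ <= X]big_split; apply: ler_sum => i _ /=.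
by rewrite -mulrDl ler_wpM2r ?invr_ge0 ?exprn_ge0 // ler_distD.
Qed.

(** Together with [inv_dist_coord], this says that on bounded sequences the
    metric induces the product topology, with uniform constants. *)
Lemma inv_dist_small (e : R) : 0 < e -> exists j, exists2 r : R, 0 < r &
  forall x y, bounded x -> bounded y ->
  (forall i, (i < j)%N -> `|x i - y i| <= r) -> inv_dist E x y < e.
Proof.
move=> e0.
case: (lerP 0 Bd) => [Bd0|Bdn]; last first.
  exists 0%N, 1 => // x y /(_ 0%N) hx.
  by have := le_trans (normr_ge0 _) hx; rewrite leNgt Bdn.
have [j hj] : exists j, 2 * Bd * (2 / 3) ^+ j <= e / 8.
  have : (fun n => 2 * Bd * (2 / 3) ^+ n : R) @ \oo --> (2 * Bd * 0 : R).
    by apply: cvgMl_tmp; apply: cvg_expr; rewrite ger0_norm; lra.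
  rewrite mulr0 => /cvgrPdist_le/(_ (e / 8)) [|N _ hN]; first by rewrite divr_gt0.
  exists N; have := hN N (leqnn N); rewrite sub0r normrN => /(le_trans (ler_norm _)).
  exact.
exists j, (e / 8); first by rewrite divr_gt0.
have e80 : 0 <= e / 8 by rewrite divr_ge0 ?ltW.
move=> x y hx hy h; apply: (@le_lt_trans _ _ (4 * (e / 8))); last by lra.
apply: inv_dist_le => // i; case: (ltnP i j) => ij.
  apply: le_trans (_ : e / 8 / 2 ^+ i <= _).
    by rewrite ler_wpM2r ?invr_ge0 ?exprn_ge0 // h.
  rewrite ler_wpM2l // -exprVn lerXn2r ?nnegrE; lra.
apply: le_trans (tail_term_le i hx hy) _.
rewrite ler_wpM2r ?exprn_ge0 //; apply: le_trans hj.
rewrite ler_wpM2l ?mulr_ge0 //; apply: ler_wiXn2l => //; lra.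
Qed.

End InvDist.

(** * Compactness *)

(** The Lebesgue number lemma, for a relation that holds near each point of the
    diagonal of L. *)
Lemma compact_lebesgue (R : realType) (E : normedModType R) (L : set E)
    (P : E -> E -> Prop) : compact L ->
  (forall x, L x -> exists2 r : R, 0 < r &
     forall x' y, `|x - x'| < r -> `|x - y| < r -> P x' y) ->
  exists2 r : R, 0 < r & forall x y, L x -> `|x - y| < r -> P x y.
Proof.
move=> /compact_near_coveringP cL hP.
have : \forall r \near 0^'+,
    L `<=` (fun x => forall y, `|x - y| < r -> P x y).
  apply: (cL R 0^'+ (fun r x => forall y, `|x - y| < r -> P x y)) => x Lx.
  have [r r0 hr] := hP _ Lx.
  exists (ball x (r / 2), [set s : R | s < r / 2]).
    split => /=; first by apply: nbhsx_ballx; rewrite divr_gt0.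
    by apply: nbhs_right_lt; rewrite divr_gt0.
  move=> [x' s] [/= xx' sr] y x'y.
  rewrite -ball_normE /= in xx'.
  apply: hr; first by apply: lt_trans xx' _; lra.
  apply: le_lt_trans (ler_distD x' _ _) _; lra.
move=> h; near (0 : R)^'+ => r; exists r => [|x y Lx]; first by [].
by apply: (near h r).
Unshelve. all: by end_near. Qed.

Lemma compact_uniform_continuous (R : realType) (E G : normedModType R)
    (L : set E) (h : E -> G) : compact L ->
  (forall x, L x -> {for x, continuous h}) ->
  forall e : R, 0 < e -> exists2 r : R, 0 < r &
    forall x y, L x -> `|x - y| < r -> `|h x - h y| < e.
Proof.
move=> cL hc e e0; apply: (compact_lebesgue (P := fun x y => `|h x - h y| < e)) => // x Lx.
have /cvgrPdist_lt/(_ (e / 2)) := hc _ Lx.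
rewrite divr_gt0 // => /(_ isT)/nbhs_ballP[r /= r0 hr].
exists r => // x' y; rewrite -!ball_normE /= in hr * => xx' xy.
have := hr _ xx'; have := hr _ xy => /= h1 h2.
apply: le_lt_trans (ler_distD (h x) _ _) _.
by rewrite distrC; lra.
Qed.

Lemma compact_open_margin (R : realType) (E : normedModType R) (L V : set E) :
  compact L -> open V -> L `<=` V ->
  exists2 r : R, 0 < r & forall x y, L x -> `|x - y| < r -> V y.
Proof.
move=> cL oV LV; apply: (compact_lebesgue (P := fun _ y => V y)) => // x Lx.
have /nbhs_ballP[r /= r0 hr] : nbhs x V by apply: open_nbhs_nbhs; split => //; apply: LV.
by exists r => // x' y _; rewrite -ball_normE in hr; apply: hr.
Qed.

Section InverseLimit.
Context (R : realType) (E : normedModType R) (f : E -> E) (L : set E).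
Hypotheses (cL : compact L) (fL : f @` L = L)
  (fc : forall x, L x -> {for x, continuous f}).

Let X := inverse_limit f L.
Let d := @inv_dist R E.

Lemma compact_norm_le : exists2 Bd : R, 0 < Bd & forall x, L x -> `|x| <= Bd.
Proof.
have /compact_bounded [M [_ hM]] := cL.
exists (Num.max M 0 + 1); first by rewrite ltr_wpDl // le_max lexx orbT.
by move=> x Lx; apply: (hM (Num.max M 0 + 1)) => //; rewrite ltr_pwDr // le_max lexx.
Qed.

(** A cluster point in the product of copies of L, given by Tychonoff's theorem,
    still satisfies f (p (i + 1)) = p i by continuity of f at p (i + 1), which is
    a point of L; f may be discontinuous elsewhere. *)
Lemma inverse_limit_compact :
  compact (X : set (prod_topology (fun _ : nat => E))).
Proof.
move=> FF PF FX.
have FL : FF [set x | forall i, L (x i)].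
  by apply: filterS FX => x Xx i; case: (Xx i).
have [p [Lp cp]] := tychonoff (fun _ => cL) PF FL.
exists p; split => // i; split; first exact: Lp.
apply/eqP; rewrite -subr_eq0 -normr_le0; apply/ler_addgt0Pl => e e0; rewrite addr0.
have e20 : 0 < e / 2 by rewrite divr_gt0.
pose U := [set x : prod_topology (fun _ : nat => E) |
  `|f (p i.+1) - f (x i.+1)| < e / 2 /\ `|p i - x i| < e / 2].
have nU : nbhs (p : prod_topology (fun _ : nat => E)) U.
  apply: filterI.
    have := @proj_continuous _ (fun _ : nat => E) i.+1 p.
    have /cvgrPdist_lt/(_ _ e20) h := fc (Lp i.+1).
    by move=> /(_ _ h).
  have := @proj_continuous _ (fun _ : nat => E) i p.
  have /cvgrPdist_lt/(_ _ e20) h : (x @[x --> p i] --> p i) by exact: cvg_id.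
  by move=> /(_ _ h).
have [x [Xx [h1 h2]]] := cp _ _ FX nU.
have [_ fx] := Xx i; rewrite fx in h1.
apply: le_trans (ler_distD (x i) _ _) _; rewrite [X in _ + X]distrC; lra.
Qed.

(** Compactness in terms of the metric: a property of n and x that holds for
    large n locally in x holds for large n uniformly in x. *)
Lemma near_covering_limit (P : nat -> (nat -> E) -> Prop) :
  (forall x, X x -> exists2 r : R, 0 < r & exists N, forall n x',
     (N <= n)%N -> X x' -> d x x' < r -> P n x') ->
  exists N, forall n x, (N <= n)%N -> X x -> P n x.
Proof.
move=> hP; have [Bd Bd0 hBd] := compact_norm_le.
have bX x : X x -> forall i, `|x i| <= Bd by move=> Xx i; apply: hBd; case: (Xx i).
have /compact_near_coveringP cX := inverse_limit_compact.
have [N _ hN] : \forall n \near \oo,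
    (X : set (prod_topology (fun _ : nat => E))) `<=` (fun x => X x -> P n x).
  apply: (cX nat \oo (fun n x => X x -> P n x)) => x Xx.
  have [r r0 [N hN]] := hP _ Xx.
  have [j [s s0 hs]] := inv_dist_small E Bd r0.
  exists ([set x' : nat -> E | forall i : 'I_j, `|x i - x' i| <= s], [set n | (N <= n)%N]).
    split => /=; last by exists N.
    apply: (@filter_forall _ _ (fun (i : 'I_j) (x' : nat -> E) => `|x i - x' i| <= s)
      _ (nbhs_filter (x : prod_topology (fun _ : nat => E)))) => i.
    have := @proj_continuous _ (fun _ : nat => E) (i : nat) x.
    have /cvgrPdist_le/(_ _ s0) h : (y @[y --> x i] --> x i) by exact: cvg_id.
    by move=> /(_ _ h).
  move=> [x' n] [/= xx' Nn] Xx'; apply: hN => //; apply: hs; [exact: bX..|].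
  by move=> i ij; apply: (xx' (Ordinal ij)).
by exists N => n x Nn Xx; apply: (hN n).
Qed.

Lemma limit_bounded (h : (nat -> E) -> R) :
  (forall x, X x -> exists2 r : R, 0 < r & exists a : R,
     forall x', X x' -> d x x' < r -> h x' <= a) ->
  exists a : R, forall x, X x -> h x <= a.
Proof.
move=> hh.
have [N hN] : exists N, forall n x, (N <= n)%N -> X x -> h x <= n%:R.
  apply: near_covering_limit => x Xx; have [r r0 [a ha]] := hh _ Xx.
  exists r => //; exists (Num.bound (Num.max a 0)) => n x' hn Xx' xx'.
  apply: le_trans (ha _ Xx' xx') _.
  have : Num.max a 0 < (Num.bound (Num.max a 0))%:R.
    by apply: archi_boundP; rewrite le_max lexx orbT.
  have : (Num.bound (Num.max a 0))%:R <= n%:R :> R by rewrite ler_nat.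
  have : a <= Num.max a 0 by rewrite le_max lexx.
  lra.
by exists N%:R => x; apply: hN.
Qed.

Lemma limit_uniform_continuous (G : normedModType R) (h : (nat -> E) -> G) :
  (forall x, X x -> forall e : R, 0 < e -> exists2 r : R, 0 < r &
     forall y, X y -> d x y < r -> `|h x - h y| < e) ->
  forall e : R, 0 < e -> exists2 r : R, 0 < r &
    forall x y, X x -> X y -> d x y < r -> `|h x - h y| < e.
Proof.
move=> hc e e0; have [Bd Bd0 hBd] := compact_norm_le.
have bX x : X x -> forall i, `|x i| <= Bd by move=> Xx i; apply: hBd; case: (Xx i).
have [N hN] : exists N, forall n x, (N <= n)%N -> X x ->
    forall y, X y -> d x y < n.+1%:R^-1 -> `|h x - h y| < e.
  apply: near_covering_limit => x Xx.
  have [|r r0 hr] := hc _ Xx (e / 2); first by rewrite divr_gt0.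
  have r20 : 0 < r / 2 by rewrite divr_gt0.
  exists (r / 2) => //; exists (Num.bound (r / 2)^-1) => n x' hn Xx' xx' y Xy x'y.
  have hx' : `|h x - h x'| < e / 2 by apply: hr => //; lra.
  have hy : `|h x - h y| < e / 2.
    apply: hr => //; apply: le_lt_trans (inv_dist_triangle (bX _ Xx) (bX _ Xx') (bX _ Xy)) _.
    have : n.+1%:R^-1 <= r / 2.
      rewrite -[r / 2]invrK lef_pV2 ?posrE ?invr_gt0 //.
      have : (r / 2)^-1 < (Num.bound (r / 2)^-1)%:R by apply: archi_boundP; rewrite invr_ge0 ltW.
      have : (Num.bound (r / 2)^-1)%:R <= n.+1%:R :> R by rewrite ler_nat leqW.
      lra.
    move=> hn1; apply: lt_le_trans (ltrD xx' (lt_le_trans x'y hn1)) _; lra.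
  by apply: le_lt_trans (ler_distD (h x) _ _) _; rewrite distrC; lra.
by exists N.+1%:R^-1 => // x y Xx Xy; apply: (hN N).
Qed.

End InverseLimit.

(** * Uniform differentiability *)

Section StrictDifferentiability.
Context (R : realType) (E : normedModType R) (F : frame E).

Lemma frame_coord_continuous i : continuous (frame_coord F i).
Proof.
move=> x; apply/cvgrPdist_lt => e e0; apply/nbhs_ballP; exists e => //= y.
rewrite -ball_normE /= => xy; rewrite -linearB; apply: le_lt_trans xy; exact: frame_coord_le.
Qed.

(** The mean value theorem fails for vector-valued functions but holds for each
    coordinate of t |-> f (a + t w) - t T w. *)
Lemma mean_value_bound (f : E -> E) (T : {linear E -> E}) (a w : E) (c : R) :
  (forall t : R, 0 <= t <= 1 -> differentiable f (a + t *: w) /\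
     `|'d f (a + t *: w) w - T w| <= c) ->
  `|f (a + w) - f a - T w| <= (\sum_i `|frame_vec F i|) * c.
Proof.
move=> h; apply: frame_norm_bound => i.
pose line : R^o -> E := cst a + ( *:%R ^~ w).
pose phi : R -> R := frame_coord F i \o (f \o line).
pose Dphi (t : R) := frame_coord F i ('d f (a + t *: w) w).
have dphi (t : R) : t \in `[0, 1] -> is_derive t 1 phi (Dphi t).
  rewrite in_itv /= => t01; have [df _] := h t t01.
  have dl : is_diff (t : R^o) line (0 + ( *:%R ^~ w)) by exact: is_diffD.
  have dfl : is_diff (line t) f ('d f (line t)) by apply: DiffDef.
  have dc : is_diff (f (line t)) (frame_coord F i) (frame_coord F i).
    apply: DiffDef; first exact/linear_differentiable/frame_coord_continuous.
    by rewrite diff_lin //; apply: frame_coord_continuous.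
  have dp : is_diff t phi (frame_coord F i \o ('d f (line t) \o (0 + ( *:%R ^~ w)))).
    by apply: is_diff_comp.
  apply: DeriveDef; first by apply: diff_derivable; apply: ex_diff.
  rewrite deriveE; last exact: ex_diff.
  by rewrite diff_val /Dphi /= /GRing.add_fun /= add0r scale1r.
have dphi_oo (t : R) : t \in `]0, 1[ -> is_derive t 1 phi (Dphi t).
  by move=> t01; apply: dphi; apply: subset_itv_oo_cc.
have cphi : {within `[0, 1], continuous phi}.
  apply: derivable_within_continuous => t t01; exact: (ex_derive (is_derive := dphi t t01)).
have [t t01 e] := MVT ltr01 dphi_oo cphi.
have {}t01 : 0 <= t <= 1 by have := subset_itv_oo_cc t01; rewrite in_itv.
have -> : frame_coord F i (f (a + w) - f a - T w) = frame_coord F i ('d f (a + t *: w) w - T w).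
  rewrite !linearB; congr (_ - _).
  have phiE s : phi s = frame_coord F i (f (a + s *: w)) by [].
  by move: e; rewrite subr0 mulr1 !phiE scale1r scale0r addr0.
by apply: le_trans (frame_coord_le _ _) _; have [] := h t t01.
Qed.

(** Continuity of the differential is given on each vector separately; finitely
    many basis vectors suffice to make it continuous in operator norm. *)
Lemma differential_uniform_continuous (f : E -> E) (L : set E) :
  compact L -> smooth_near f L ->
  forall e : R, 0 < e -> exists2 r : R, 0 < r & forall x y, L x -> `|x - y| < r ->
    differentiable f y /\ forall v, `|'d f y v - 'd f x v| <= e * `|v|.
Proof.
move=> cL [U [oU LU hU]] e e0.
pose n := (frame_dim F)%:R : R.
pose a := e / (n + 1).
have n0 : 0 < n + 1 by rewrite ltr_wpDl // ler0n.
have a0 : 0 < a by rewrite divr_gt0.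
have [r r0 hr] : exists2 r : R, 0 < r & forall x y, L x -> `|x - y| < r ->
    U x /\ (U y /\ forall i, `|'d f y (frame_vec F i) - 'd f x (frame_vec F i)| < a).
  apply: (compact_lebesgue (P := fun x y => U x /\ (U y /\
    forall i, `|'d f y (frame_vec F i) - 'd f x (frame_vec F i)| < a))) => // x Lx.
  have a20 : 0 < a / 2 by rewrite divr_gt0.
  have Ux := LU _ Lx.
  have : \forall y \near x, U y /\
      forall i, `|'d f x (frame_vec F i) - 'd f y (frame_vec F i)| < a / 2.
    apply: filterI; first exact: open_nbhs_nbhs.
    apply: filter_forall => i; have [_ /(_ (frame_vec F i))] := hU _ Ux.
    by move=> /cvgrPdist_lt; apply.
  move=> /nbhs_ballP[r /= r0 hr]; exists r => // x' y.
  rewrite -ball_normE /= in hr.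
  move=> /hr[Ux' h1] /hr[Uy h2]; split=> //; split=> // i.
  apply: le_lt_trans (ler_distD ('d f x (frame_vec F i)) _ _) _.
  by have := h1 i; have := h2 i; rewrite distrC; lra.
exists r => // x y Lx xy; have [Ux [Uy hd]] := hr _ _ Lx xy.
split=> [|v]; first by case: (hU _ Uy).
have := @frame_linear_bound _ _ F (fun v => 'd f y v - 'd f x v) a _ _ v.
move=> h; apply: le_trans (h _ _) _.
- move=> k u w /=; rewrite (linearP ('d f y)) (linearP ('d f x)).
  by rewrite scalerBr opprD addrACA.
- by move=> i; apply: ltW.
rewrite ler_wpM2r // /a mulrCA ler_piMr ?ltW //.
by rewrite ltr_pdivrMr // mul1r ltrDl.
Qed.

(** Near the points of L, f minus its differential is Lipschitz with small
    constant: this is what makes the contraction argument work uniformly. *)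
Lemma strict_differentiable (f : E -> E) (L : set E) :
  compact L -> smooth_near f L ->
  forall e : R, 0 < e -> exists2 r : R, 0 < r & forall x u v, L x ->
    `|u| <= r -> `|v| <= r ->
    `|f (x + u) - f (x + v) - 'd f x (u - v)| <= e * `|u - v|.
Proof.
move=> cL sf e e0.
pose B := \sum_i `|frame_vec F i|.
have B0 : 0 <= B by apply: sumr_ge0.
have eB : 0 < e / (B + 1) by rewrite divr_gt0 // ltr_wpDl.
have [r r0 hr] := differential_uniform_continuous cL sf eB.
(* The segment from v to u stays within |v| + |u - v| <= 3 r / 4 of 0. *)
exists (r / 4); first by rewrite divr_gt0.
move=> x u v Lx hu hv.
have -> : x + u = x + v + (u - v) by rewrite addrA addrAC addrK.
apply: le_trans (mean_value_bound (c := e / (B + 1) * `|u - v|) _) _.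
  move=> t /andP[t0 t1].
  have ht : `|x - (x + v + t *: (u - v))| < r.
    rewrite -addrA opprD addNKr normrN.
    apply: le_lt_trans (ler_normD _ _) _.
    have h1 : `|t *: (u - v)| <= `|u - v| by rewrite normrZ ler_piMl // ger0_norm.
    have := ler_normB u v; lra.
  by have [h1 h2] := hr _ _ Lx ht; split.
rewrite -/B mulrA ler_wpM2r // mulrCA ler_piMr ?ltW //.
by rewrite ltr_pdivrMr ?mul1r ?ltrDl // ltr_wpDl.
Qed.

End StrictDifferentiability.

(** * Iterates near an invariant set *)

Section Iterates.
Context (R : realType) (E : normedModType R) (F : frame E) (f : E -> E) (L : set E).
Hypotheses (cL : compact L) (fL : f @` L = L) (sf : smooth_near f L).

Lemma smooth_near_continuous x : L x -> {for x, continuous f}.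
Proof.
case: sf => U [_ LU hU] Lx; have [df _] := hU _ (LU _ Lx).
exact: differentiable_continuous.
Qed.

Lemma smooth_near_differentiable x : L x -> differentiable f x.
Proof. by case: sf => U [_ LU hU] Lx; have [] := hU _ (LU _ Lx). Qed.

Lemma iter_invariant n x : L x -> L (iter n f x).
Proof. by move=> Lx; elim: n => // n IH; rewrite iterS -fL; exists (iter n f x). Qed.

Lemma iter_differentiable n x : L x -> differentiable (iter n f) x.
Proof.
move=> Lx; elim: n => [|n IH].
  have -> : iter 0 f = id by apply/funext.
  exact: ex_diff.
have -> : iter n.+1 f = f \o iter n f by apply/funext.
apply: differentiable_comp => //.
exact/smooth_near_differentiable/iter_invariant.
Qed.

Lemma diff_iterS n x v : L x ->
  'd (iter n.+1 f) x v = 'd f (iter n f x) ('d (iter n f) x v).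
Proof.
move=> Lx; have -> : iter n.+1 f = f \o iter n f by apply/funext.
rewrite diff_comp //; first exact: iter_differentiable.
exact/smooth_near_differentiable/iter_invariant.
Qed.

Lemma diff_iter0 x v : 'd (iter 0 f) x v = v.
Proof.
have -> : iter 0 f = id by apply/funext.
by rewrite diff_val.
Qed.

Lemma differential_bounded :
  exists2 M : R, 0 <= M & forall x v, L x -> `|'d f x v| <= M * `|v|.
Proof.
have [r r0 hr] := differential_uniform_continuous F cL sf ltr01.
have /compact_near_coveringP cL' := cL.
have [N _ hN] : \forall n \near \oo,
    L `<=` (fun x => L x -> forall v, `|'d f x v| <= n%:R * `|v|).
  apply: (cL' nat \oo (fun n x => L x -> forall v, `|'d f x v| <= n%:R * `|v|)) => x Lx.
  pose a := \sum_i `|'d f x (frame_vec F i)|.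
  have ha i : `|'d f x (frame_vec F i)| <= a.
    by rewrite /a (bigD1 i) //= lerDl sumr_ge0.
  have hx v : `|'d f x v| <= (frame_dim F)%:R * a * `|v|.
    by apply: frame_linear_bound => // k u w; rewrite linearP.
  pose b := (frame_dim F)%:R * a.
  have b0 : 0 <= b by rewrite mulr_ge0 // sumr_ge0.
  exists (ball x r, [set n | (Num.bound (b + 1) <= n)%N]).
    by split => /=; [exact: nbhsx_ballx | exists (Num.bound (b + 1))].
  move=> [x' n] [/= xx' hn] Lx' v.
  rewrite -ball_normE /= in xx'.
  have [_ /(_ v) h] := hr _ _ Lx xx'.
  have hb : b + 1 <= n%:R.
    have h1 : b + 1 < (Num.bound (b + 1))%:R by apply: archi_boundP; rewrite addr_ge0.
    have : (Num.bound (b + 1))%:R <= n%:R :> R by rewrite ler_nat.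
    lra.
  apply: le_trans (_ : (b + 1) * `|v| <= _); last by rewrite ler_wpM2r.
  rewrite mulrDl; have := hx v; rewrite -/b.
  have : `|'d f x' v| <= `|'d f x v| + `|'d f x' v - 'd f x v|.
    by rewrite addrC -lerBlDr lerB_dist.
  lra.
by exists N%:R => [|x v Lx]; [exact: ler0n | exact: (hN N (leqnn N) x Lx Lx v)].
Qed.

Lemma iter_differential_bounded n :
  exists2 M : R, 0 <= M & forall x v, L x -> `|'d (iter n f) x v| <= M * `|v|.
Proof.
have [M M0 hM] := differential_bounded.
elim: n => [|n [Mn Mn0 hMn]].
  by exists 1 => // x v _; rewrite diff_iter0 mul1r.
exists (M * Mn); first by rewrite mulr_ge0.
move=> x v Lx; rewrite diff_iterS //.
apply: le_trans (hM _ _ (iter_invariant n Lx)) _.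
by rewrite -mulrA ler_wpM2l // hMn.
Qed.

(** By composition, which avoids any study of the differential of an iterate
    away from L. *)
Lemma iter_strict_differentiable n :
  forall e : R, 0 < e -> exists2 r : R, 0 < r & forall x u v, L x ->
    `|u| <= r -> `|v| <= r ->
    `|iter n f (x + u) - iter n f (x + v) - 'd (iter n f) x (u - v)| <= e * `|u - v|.
Proof.
have [M M0 hM] := differential_bounded.
elim: n => [|n IH] e e0.
  exists 1 => // x u v _ _ _.
  by rewrite diff_iter0 /= opprD addrACA subrr add0r subrr normr0 mulr_ge0 // ltW.
have [Mn Mn0 hMn] := iter_differential_bounded n.
have e10 : 0 < e / 2 / (Mn + 1) by rewrite !divr_gt0 // ltr_wpDl.
have e20 : 0 < e / 2 / (M + 1) by rewrite !divr_gt0 // ltr_wpDl.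
have [r1 r10 h1] := strict_differentiable F cL sf e10.
have [r2 r20 h2] := IH _ e20.
have [r3 r30 h3] := IH _ ltr01.
have m0 : 0 < Mn + 1 by rewrite ltr_wpDl.
have m10 : 0 < M + 1 by rewrite ltr_wpDl.
pose r := Num.min (r1 / (Mn + 1)) (Num.min r2 r3).
have r0 : 0 < r by rewrite !lt_min r20 r30 divr_gt0.
exists r => // x u v Lx; rewrite !le_min => /and3P[ur1 ur2 ur3] /and3P[vr1 vr2 vr3].
have lip a b : `|a| <= r3 -> `|b| <= r3 ->
    `|iter n f (x + a) - iter n f (x + b)| <= (Mn + 1) * `|a - b|.
  move=> ha hb; rewrite -[X in `|X|](subrK ('d (iter n f) x (a - b))).
  apply: le_trans (ler_normD _ _) _; rewrite mulrDl addrC.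
  by apply: lerD; [exact: hMn | exact: h3].
have bnd a : `|a| <= r1 / (Mn + 1) -> `|a| <= r3 ->
    `|iter n f (x + a) - iter n f x| <= r1.
  move=> ha1 ha3; have := lip a 0 ha3; rewrite normr0 addr0 subr0 => /(_ (ltW r30)) h.
  by apply: le_trans h _; rewrite mulrC -ler_pdivlMr.
set y := iter n f x in bnd.
set u' := iter n f (x + u) - y; set v' := iter n f (x + v) - y.
have Eu : iter n.+1 f (x + u) = f (y + u') by rewrite iterS /u' [y + _]addrC subrK.
have Ev : iter n.+1 f (x + v) = f (y + v') by rewrite iterS /v' [y + _]addrC subrK.
have Ly : L y by apply: iter_invariant.
have uv' : u' - v' = iter n f (x + u) - iter n f (x + v).
  by rewrite /u' /v' subrACA subrr subr0.
rewrite Eu Ev diff_iterS // -/y.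
set w := 'd (iter n f) x (u - v).
have -> : f (y + u') - f (y + v') - 'd f y w =
    (f (y + u') - f (y + v') - 'd f y (u' - v')) + 'd f y (u' - v' - w).
  by rewrite (linearB ('d f y) (u' - v') w) [RHS]addrA subrK.
apply: le_trans (ler_normD _ _) _.
have -> : e * `|u - v| = e / 2 * `|u - v| + e / 2 * `|u - v| by field.
apply: lerD.
  apply: le_trans (h1 _ _ _ Ly (bnd _ ur1 ur3) (bnd _ vr1 vr3)) _.
  apply: le_trans (_ : e / 2 / (Mn + 1) * ((Mn + 1) * `|u - v|) <= _).
    by apply: ler_wpM2l; [exact: ltW | rewrite uv'; apply: lip].
  by rewrite mulrA mulfVK // gt_eqF.
apply: le_trans (hM _ _ Ly) _.
apply: le_trans (_ : M * (e / 2 / (M + 1) * `|u - v|) <= _).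
  by apply: ler_wpM2l => //; rewrite uv'; apply: h2.
rewrite mulrA ler_wpM2r // mulrCA ler_piMr ?divr_ge0 ?ltW //.
by rewrite ltr_pdivrMr // mul1r ltrDl.
Qed.

End Iterates.

(** * Shadowing for an iterate *)

Lemma finite_pos_min (R : realType) n (r : 'I_n -> R) : (forall i, 0 < r i) ->
  exists2 s : R, 0 < s & forall i, s <= r i.
Proof.
elim: n r => [|n IH] r hr; first by exists 1 => // -[].
have [s s0 hs] := IH (fun i => r (lift ord0 i)) (fun i => hr _).
exists (Num.min s (r ord0)); first by rewrite lt_min s0 hr.
move=> i; rewrite ge_min; case: (unliftP ord0 i) => [j ->|->].
  by rewrite hs.
by rewrite lexx orbT.
Qed.

(** One step of g takes time n: n = 1 for an orbit of f, and n = N for g = f^N. *)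
Definition shadowing_orbit (R : realType) (E : normedModType R) (g : E -> E)
    (n : nat) (rho : R) (xi : int -> nat -> E) (z : int -> E) : Prop :=
  (forall t, `|z t - xi t 0%N| <= rho) /\ (forall t, g (z t) = z (t + n%:Z)).

Definition uniquely_shadowed (R : realType) (E : normedModType R) (g : E -> E)
    (n : nat) (rho : R) (xi : int -> nat -> E) : Prop :=
  (exists z, shadowing_orbit g n rho xi z) /\
  (forall z z', shadowing_orbit g n rho xi z -> shadowing_orbit g n rho xi z' ->
     z =1 z').

Section HyperbolicSet.
Context (R : realType) (E : normedModType R) (F : frame E) (f : E -> E) (L : set E).
Hypotheses (cL : compact L) (fL : f @` L = L).

Let X := inverse_limit f L.
Let fhat := limit_shift f.
Let d := @inv_dist R E.

Lemma shift_inverse_limit x : X x -> X (fhat x).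
Proof.
move=> Xx [|i] /=; last exact: Xx.
by split=> //; rewrite -fL; exists (x 0%N) => //; case: (Xx 0%N).
Qed.

Lemma iter_shift_inverse_limit n x : X x -> X (iter n fhat x).
Proof. by move=> Xx; elim: n => // n; apply: shift_inverse_limit. Qed.

Lemma iter_shift0 n x : iter n fhat x 0%N = iter n f (x 0%N).
Proof. by elim: n => // n IH; rewrite !iterS -IH. Qed.

Lemma iter_shift_ge n x i : iter n fhat x (n + i)%N = x i.
Proof. by elim: n => // n IH; rewrite iterS addSn /= IH. Qed.

Lemma unshift_inverse_limit x : X x -> X (limit_unshift E x).
Proof. by move=> Xx i; apply: Xx. Qed.

Lemma unshiftK x : X x -> fhat (limit_unshift E x) = x.
Proof. by move=> Xx; apply/funext => -[|i] //=; have [] := Xx 0%N. Qed.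

Lemma inverse_limit_bounded : exists Bd : R, forall x, X x -> forall i, `|x i| <= Bd.
Proof.
have [Bd _ hBd] := compact_norm_le cL.
by exists Bd => x Xx i; apply: hBd; case: (Xx i).
Qed.

Section Splitting.
Hypothesis sf : smooth_near f L.
Context (Es : E -> set E) (Eu : (nat -> E) -> set E) (pi : (nat -> E) -> E -> E).
Hypotheses
  (subsp : forall xh, X xh -> [/\ subspace_of (Es (xh 0%N)), subspace_of (Eu xh)
       & Es (xh 0%N) `&` Eu xh = [set 0]])
  (pi_split : forall xh v, X xh -> Es (xh 0%N) (pi xh v) /\ Eu xh (v - pi xh v))
  (pi_cont : forall xh v, X xh -> forall e : R, 0 < e -> exists2 r : R, 0 < r &
       forall yh, X yh -> d xh yh < r -> `|pi xh v - pi yh v| < e).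

Let fc := smooth_near_continuous sf.

(** Since the two spaces meet only in 0, [pi] is determined by the splitting; in
    particular it is linear, which is not part of its definition. *)
Lemma splitting_unique xh s u : X xh -> Es (xh 0%N) s -> Eu xh u ->
  pi xh (s + u) = s.
Proof.
move=> Xx hs hu; have [[Es0 EsD] [Eu0 EuD] EsEu] := subsp Xx.
have [h1 h2] := pi_split (s + u) Xx.
apply/eqP; rewrite -subr_eq0; apply/eqP.
suff : (Es (xh 0%N) `&` Eu xh) (pi xh (s + u) - s) by rewrite EsEu.
split; first by rewrite addrC -scaleN1r; apply: EsD.
have -> : pi xh (s + u) - s = (-1) *: (s + u - pi xh (s + u)) + u.
  by rewrite scaleN1r opprB -addrA opprD addrNK.
exact: EuD.
Qed.

Lemma pi_linear xh : X xh -> linear (pi xh).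
Proof.
move=> Xx a u v; have [[Es0 EsD] [Eu0 EuD] EsEu] := subsp Xx.
have [h1 h2] := pi_split u Xx; have [h3 h4] := pi_split v Xx.
have -> : a *: u + v = (a *: pi xh u + pi xh v) + (a *: (u - pi xh u) + (v - pi xh v)).
  by rewrite addrACA -scalerDr [pi xh u + _]addrC subrK [pi xh v + _]addrC subrK.
by rewrite splitting_unique //; [apply: EsD | apply: EuD].
Qed.

Lemma pi_sub xh : X xh -> {morph pi xh : u v / u - v}.
Proof.
move=> Xx u v; have := pi_linear Xx (-1) v u.
by rewrite !scaleN1r ![- _ + _]addrC.
Qed.

Lemma pi_stable xh s : X xh -> Es (xh 0%N) s -> pi xh s = s.
Proof.
move=> Xx hs; rewrite -{1}[s]addr0 splitting_unique //.
by have [_ [Eu0 _] _] := subsp Xx.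
Qed.

Lemma pi_unstable xh v : X xh -> pi xh v = 0 <-> Eu xh v.
Proof.
move=> Xx; split=> hv; first by have [_] := pi_split v Xx; rewrite hv subr0.
rewrite -[v]add0r splitting_unique //.
by have [[Es0 _] _ _] := subsp Xx.
Qed.

(** Local bounds on the images of basis vectors, made global by compactness of
    the inverse limit. *)
Lemma pi_bounded : exists2 K : R, 0 <= K &
  forall xh v, X xh -> `|pi xh v| <= K * `|v|.
Proof.
have [a ha] : exists a : R, forall xh, X xh -> \sum_i `|pi xh (frame_vec F i)| <= a.
  apply: (limit_bounded cL fc) => xh Xx.
  have hr i := pi_cont (frame_vec F i) Xx ltr01.
  pose r i := projT1 (cid2 (hr i)).
  have r0 i : 0 < r i by rewrite /r; case: cid2.
  have [s s0 hs] := finite_pos_min r0.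
  exists s => //; exists (\sum_i (`|pi xh (frame_vec F i)| + 1)) => yh Xy xy.
  apply: ler_sum => i _.
  have : `|pi xh (frame_vec F i) - pi yh (frame_vec F i)| < 1.
    have := lt_le_trans xy (hs i); rewrite /r; case: cid2 => /= q _; exact.
  have : `|pi yh (frame_vec F i)| <= `|pi xh (frame_vec F i)| +
         `|pi xh (frame_vec F i) - pi yh (frame_vec F i)|.
    by rewrite -[X in `|X|](subKr (pi xh (frame_vec F i))) ler_normB.
  lra.
exists ((frame_dim F)%:R * Num.max a 0).
  by rewrite mulr_ge0 // le_max lexx orbT.
move=> xh v Xx; apply: frame_linear_bound; first exact: pi_linear.
move=> i; rewrite le_max; apply/orP; left; apply: le_trans (ha _ Xx).
by rewrite (bigD1 i) //= lerDl sumr_ge0.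
Qed.

Lemma pi_uniform_continuous (e : R) : 0 < e -> exists2 r : R, 0 < r &
  forall xh yh, X xh -> X yh -> d xh yh < r ->
  forall v, `|pi xh v - pi yh v| <= e * `|v|.
Proof.
move=> e0; pose n := (frame_dim F)%:R : R.
have n0 : 0 < n + 1 by rewrite ltr_wpDl // ler0n.
have a0 : 0 < e / (n + 1) by rewrite divr_gt0.
have hr i : exists2 r : R, 0 < r & forall x y, X x -> X y -> d x y < r ->
    `|pi x (frame_vec F i) - pi y (frame_vec F i)| < e / (n + 1).
  apply: (limit_uniform_continuous cL fc (h := fun x => pi x (frame_vec F i))) => //.
  by move=> x Xx; apply: pi_cont.
pose r i := projT1 (cid2 (hr i)).
have r0 i : 0 < r i by rewrite /r; case: cid2.
have [s s0 hs] := finite_pos_min r0.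
exists s => // x y Xx Xy xy v.
have := @frame_linear_bound _ _ F (fun v => pi x v - pi y v) (e / (n + 1)) _ _ v.
move=> h; apply: le_trans (h _ _) _.
- move=> k u w /=; rewrite (pi_linear Xx) (pi_linear Xy).
  by rewrite scalerBr opprD addrACA.
- move=> i; apply: ltW.
  have := lt_le_trans xy (hs i); rewrite /r; case: cid2 => /= q _; exact.
rewrite ler_wpM2r // mulrCA ler_piMr ?ltW //.
by rewrite ltr_pdivrMr // mul1r ltrDl.
Qed.

Section Shadowing.
Context (C lam : R).
Hypotheses (C0 : 0 < C) (lam01 : 0 < lam < 1)
  (DEs : forall x, L x -> 'd f x @` Es x `<=` Es (f x))
  (DEu : forall xh, X xh -> 'd f (xh 0%N) @` Eu xh = Eu (fhat xh))
  (contr : forall x v n, L x -> Es x v ->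
     `|'d (iter n f) x v| <= C * lam ^+ n * `|v|)
  (expand : forall xh v n, X xh -> Eu xh v ->
     C^-1 * lam ^- n * `|v| <= `|'d (iter n f) (xh 0%N) v|).

Lemma iter_diff_stable n x v : L x -> Es x v -> Es (iter n f x) ('d (iter n f) x v).
Proof.
move=> Lx hv; elim: n => [|n IH]; first by rewrite diff_iter0.
rewrite (diff_iterS fL sf) //; apply: (DEs (iter_invariant fL n Lx)).
by exists ('d (iter n f) x v).
Qed.

Lemma iter_diff_unstable n xh : X xh ->
  'd (iter n f) (xh 0%N) @` Eu xh = Eu (iter n fhat xh).
Proof.
move=> Xx; have Lx : L (xh 0%N) by case: (Xx 0%N).
elim: n => [|n IH].
  apply/seteqP; split => [_ [v hv <-]|v hv]; first by rewrite diff_iter0.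
  by exists v => //; rewrite diff_iter0.
rewrite iterS -DEu; last exact: iter_shift_inverse_limit.
rewrite -IH iter_shift0; apply/seteqP; split => [_ [v hv <-]|_ [_ [v hv <-] <-]].
  by rewrite (diff_iterS fL sf) //; exists ('d (iter n f) (xh 0%N) v) => //; exists v.
by exists v => //; rewrite (diff_iterS fL sf).
Qed.

Lemma contraction_time (mu : R) : 0 < mu -> exists N, C * lam ^+ N <= mu.
Proof.
move=> mu0; have /andP[l0 l1] := lam01.
have : (fun n => C * lam ^+ n : R) @ \oo --> (C * 0 : R).
  by apply: cvgMl_tmp; apply: cvg_expr; rewrite ger0_norm // ltW.
rewrite mulr0 => /cvgrPdist_le/(_ mu mu0)[N _ hN].
exists N; have := hN N (leqnn N); rewrite sub0r normrN => /(le_trans (ler_norm _)).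
exact.
Qed.

(** The sequence of maps is indexed by the integers with next t = t + N, so that
    f^N is followed from every starting time at once.  The stable projection at
    the source is taken at xi t, and the one at the target at the image of xi t
    under the shift; the latter is close to the projection at xi (t + N) because
    the jump is small and [pi] is uniformly continuous. *)
Lemma iterate_shadowing : exists N, exists2 rho0 : R, 0 < rho0 &
  forall rho : R, 0 < rho <= rho0 -> exists2 delta : R, 0 < delta &
  forall xi : int -> nat -> E, (forall t, X (xi t)) ->
  (forall t, d (iter N fhat (xi t)) (xi (t + N%:Z)) < delta) ->
  uniquely_shadowed (iter N f) N rho xi.
Proof.
have [K K0 hK] := pi_bounded.
have k0 : 0 < 3 * K + 2 by lra.
have [|N hN] := contraction_time (mu := 1 / 4 / (3 * K + 2)); first by rewrite !divr_gt0.
pose mu := C * lam ^+ N.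
have /andP[l0 l1] := lam01.
have mu0 : 0 < mu by rewrite mulr_gt0 ?exprn_gt0.
have mu_small : mu * (3 * K + 2) <= 1 / 4 by rewrite -ler_pdivlMr.
have [M M0 hM] := iter_differential_bounded F cL fL sf N.
(* M depends on N, so eta can only be chosen once N is fixed. *)
pose eta := 1 / 4 / (M + K + 1).
have m0 : 0 < M + K + 1 by rewrite ltr_wpDl ?addr_ge0.
have eta0 : 0 < eta by rewrite !divr_gt0.
have etaE : eta * (M + K + 1) = 1 / 4 by rewrite mulfVK // gt_eqF.
have eta_small : eta * (M + K) <= 1 / 4 by rewrite mulrDr mulr1 in etaE; lra.
have eta1 : 0 <= eta < 1.
  have := mulr_ge0 (ltW eta0) (addr_ge0 M0 K0).
  by rewrite (ltW eta0) /=; rewrite mulrDr mulr1 in etaE; lra.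
have [rho0 rho00 hrho0] := iter_strict_differentiable F cL fL sf N eta0.
have [r r0 hr] := pi_uniform_continuous eta0.
have [Bd hBd] := inverse_limit_bounded.
exists N, rho0 => // rho /andP[rhogt rhole].
have K10 : 0 < K + 1 by lra.
(* r keeps the projections within eta, the other bound keeps the image of the
   zero sequence within rho / 2. *)
exists (Num.min r (rho / 2 / (K + 1))); first by rewrite lt_min r0 !divr_gt0.
move=> xi Xxi hxi.
pose next (t : int) : int := t + N%:Z; pose prev (t : int) : int := t - N%:Z.
have nextK : cancel next prev by move=> t; rewrite /next /prev addrK.
have prevK : cancel prev next by move=> t; rewrite /next /prev subrK.
pose P t := pi (xi t); pose Q t := pi (iter N fhat (xi t)).
pose D t : E -> E := 'd (iter N f) (xi t 0%N).
pose G t v := iter N f (xi t 0%N + v) - xi (next t) 0%N.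
have Lxi t : L (xi t 0%N) by case: (Xxi t 0%N).
have Xit t : X (iter N fhat (xi t)) by apply: iter_shift_inverse_limit.
have PB t : {morph P t : u v / u - v} by apply: pi_sub.
have QB t : {morph Q t : u v / u - v} by apply: pi_sub.
have DB t : {morph D t : u v / u - v} by move=> u v; rewrite /D linearB.
have PP t v : P t (P t v) = P t v.
  by apply: pi_stable => //; case: (pi_split v (Xxi t)).
have PK t v : `|P t v| <= K * `|v| by apply: hK.
have QK t v : `|Q t v| <= K * `|v| by apply: hK.
have PQ t v : `|P (next t) v - Q t v| <= eta * `|v|.
  rewrite distrC; apply: hr => //.
  by apply: lt_le_trans (hxi t) _; rewrite ge_min lexx.
have DM t v : `|D t v| <= M * `|v| by apply: hM.
have Dstab t v : Es (xi t 0%N) v -> Es (iter N fhat (xi t) 0%N) (D t v).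
  by rewrite iter_shift0; apply: iter_diff_stable.
have QD t v : Q t (D t v) = D t (P t v).
  have [h1 h2] := pi_split v (Xxi t).
  have -> : D t v = D t (P t v) + D t (v - P t v) by rewrite DB addrC subrK.
  apply: splitting_unique => //; first exact: Dstab.
  by rewrite -iter_diff_unstable //; exists (v - P t v).
have Dst t v : `|D t (P t v)| <= mu * `|P t v|.
  by apply: contr => //; case: (pi_split v (Xxi t)).
have Dun t v : P t v = 0 -> `|v| <= mu * `|D t v|.
  move=> /(pi_unstable _ (Xxi t)) /(expand N (Xxi t)).
  by rewrite -invfM mulrC ler_pdivrMr // mulrC.
have Dsurj t w : exists v, P t v = 0 /\ D t v = w - Q t w.
  have [_] := pi_split w (Xit t); rewrite -iter_diff_unstable // => -[v hv e].
  by exists v; split => //; apply/pi_unstable.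
have Glip rh t u v : rh <= rho0 -> `|u| <= rh -> `|v| <= rh ->
    `|G t u - G t v - D t (u - v)| <= eta * `|u - v|.
  move=> hh hu hv; rewrite /G subrACA subrr subr0.
  by apply: hrho0 => //; apply: le_trans hh.
have G0 t : `|G t 0| <= rho / 2 / (K + 1).
  rewrite /G addr0 -iter_shift0.
  apply: le_trans (inv_dist_coord 0 (hBd _ (Xit t)) (hBd _ (Xxi (next t)))) _.
  rewrite expr0 mul1r; apply: ltW; apply: lt_le_trans (hxi t) _.
  by rewrite ge_min lexx orbT.
split.
  have hrho : (K + 1) * (rho / 2 / (K + 1)) <= rho / 2.
    by rewrite mulrC mulfVK // gt_eqF.
  have [v hv ov] := hyperbolic_orbit_exists F nextK prevK PB QB DB PP PK QK PQ DM QD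
    Dst Dun Dsurj (fun t u v => @Glip rho t u v rhole) K0 M0 (ltW mu0) eta1
    mu_small eta_small G0 hrho.
  exists (fun t => xi t 0%N + v t); split=> t; first by rewrite addrC addKr.
  by rewrite -/(next t) -ov /G [RHS]addrC subrK.
move=> z z' [hz oz] [hz' oz'] t.
pose u t := z t - xi t 0%N; pose u' t := z' t - xi t 0%N.
have ou s : G s (u s) = u (next s).
  by rewrite /u /G [xi s 0%N + _]addrC subrK oz.
have ou' s : G s (u' s) = u' (next s).
  by rewrite /u' /G [xi s 0%N + _]addrC subrK oz'.
apply: (@subIr _ (xi t 0%N)).
exact: (hyperbolic_orbit_unique nextK prevK PB QB DB PP PK QK PQ DM QD
    Dst Dun Dsurj (fun t u v => @Glip rho t u v rhole) K0 M0 (ltW mu0) eta1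
    mu_small eta_small hz hz' ou ou').
Qed.

End Shadowing.
End Splitting.
End HyperbolicSet.

(** * Shadowing and expansiveness for the map *)

Section ZIter.
Context (S : Type) (X : set S) (T T' : S -> S).
Hypotheses (XT : forall x, X x -> X (T x)) (XT' : forall x, X x -> X (T' x))
  (TK : forall x, X x -> T' (T x) = x) (T'K : forall x, X x -> T (T' x) = x).

Lemma ziter_stable t x : X x -> X (ziter T T' t x).
Proof.
move=> Xx; case: t => n /=; first by elim: n => //= n; apply: XT.
by apply: XT'; elim: n => //= n; apply: XT'.
Qed.

Lemma ziterS t x : X x -> T (ziter T T' t x) = ziter T T' (t + 1) x.
Proof.
move=> Xx; case: t => n.
  by have -> : Posz n + 1 = Posz n.+1 by lia.
have Xn : X (iter n T' x) by elim: n => //= n; apply: XT'.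
rewrite /= T'K //; case: n Xn => [|n] _ //.
by have -> : Negz n.+1 + 1 = Negz n by lia.
Qed.

Lemma orbit_ziter (zeta : int -> S) : (forall t, X (zeta t)) ->
  (forall t, T (zeta t) = zeta (t + 1)) ->
  forall t, ziter T T' t (zeta 0) = zeta t.
Proof.
move=> Xz hz [] n /=.
  elim: n => //= n ->; rewrite hz; congr zeta; lia.
have h k : T' (zeta k) = zeta (k - 1).
  by rewrite -{1}[k](subrK 1) -hz TK.
elim: n => [|n IH]; first by rewrite /= h.
rewrite iterS IH h; congr zeta; lia.
Qed.

End ZIter.

Section HyperbolicShadowing.
Context (R : realType) (E : normedModType R) (F : frame E) (f : E -> E) (L : set E).
Hypotheses (cL : compact L) (fL : f @` L = L) (hypf : hyperbolic f L).

Let X := inverse_limit f L.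
Let fhat := limit_shift f.
Let unshift := limit_unshift E.
Let d := @inv_dist R E.

Lemma hyperbolic_iterate_shadowing : exists N, exists2 rho0 : R, 0 < rho0 &
  forall rho : R, 0 < rho <= rho0 -> exists2 delta : R, 0 < delta &
  forall xi : int -> nat -> E, (forall t, X (xi t)) ->
  (forall t, d (iter N fhat (xi t)) (xi (t + N%:Z)) < delta) ->
  uniquely_shadowed (iter N f) N rho xi.
Proof.
case: hypf => sf [Es [Eu [[subsp [pi [pis pic]]] DEs DEu [C [lam [C0 lam01 ct ex]]]]]].
exact: (iterate_shadowing F cL fL sf subsp pis pic C0 lam01 DEs DEu ct ex).
Qed.

Let fc x (Lx : L x) : {for x, continuous f} := smooth_near_continuous hypf.1 Lx.

Lemma inverse_limit_inv_distxx x : X x -> d x x = 0.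
Proof.
move=> Xx; have [Bd hBd] := inverse_limit_bounded f cL.
apply/eqP; rewrite eq_le; apply/andP; split.
  have := inv_dist_le (c := 0) (hBd _ Xx) (hBd _ Xx) (lexx _).
  by rewrite mulr0; apply => i; rewrite subrr normr0 !mul0r.
have := inv_dist_coord 0 (hBd _ Xx) (hBd _ Xx).
by rewrite expr0 mul1r subrr normr0.
Qed.

Lemma shift_uniform_continuous (e : R) : 0 < e -> exists2 r : R, 0 < r &
  forall x y, X x -> X y -> d x y < r -> d (fhat x) (fhat y) < e.
Proof.
move=> e0; have [Bd hBd] := inverse_limit_bounded f cL.
have [j [s s0 hs]] := inv_dist_small E Bd e0.
have [r1 r10 hr1] := compact_uniform_continuous cL fc s0.
exists (Num.min r1 (s / 2 ^+ j)); first by rewrite lt_min r10 divr_gt0 ?exprn_gt0.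
move=> x y Xx Xy; rewrite lt_min => /andP[h1 h2].
have Xfx := shift_inverse_limit fL Xx; have Xfy := shift_inverse_limit fL Xy.
apply: hs; [exact: hBd Xfx | exact: hBd Xfy | move=> [|i] ij /=].
  apply/ltW/hr1; first by case: (Xx 0%N).
  apply: le_lt_trans h1; have := inv_dist_coord 0 (hBd _ Xx) (hBd _ Xy).
  by rewrite expr0 mul1r.
apply: le_trans (inv_dist_coord i (hBd _ Xx) (hBd _ Xy)) _.
apply: le_trans (_ : 2 ^+ i * (s / 2 ^+ j) <= _).
  by rewrite ler_wpM2l ?exprn_ge0 // ltW.
rewrite mulrCA ler_piMr ?ltW // ltr_pdivrMr ?exprn_gt0 // mul1r.
by rewrite ltr_eXn2l ?ltr1n // ltnW.
Qed.

Lemma unshift_uniform_continuous (e : R) : 0 < e -> exists2 r : R, 0 < r &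
  forall x y, X x -> X y -> d x y < r -> d (unshift x) (unshift y) < e.
Proof.
move=> e0; have [Bd hBd] := inverse_limit_bounded f cL.
have [j [s s0 hs]] := inv_dist_small E Bd e0.
exists (s / 2 ^+ j); first by rewrite divr_gt0 ?exprn_gt0.
move=> x y Xx Xy h.
apply: hs => [||i ij]; [by move=> i; apply: hBd Xx _ | by move=> i; apply: hBd Xy _ |].
apply: le_trans (inv_dist_coord i.+1 (hBd _ Xx) (hBd _ Xy)) _.
apply: le_trans (_ : 2 ^+ i.+1 * (s / 2 ^+ j) <= _).
  by rewrite ler_wpM2l ?exprn_ge0 // ltW.
rewrite mulrCA; apply: ler_piMr; first exact: ltW.
rewrite ler_pdivrMr ?exprn_gt0 // mul1r.
by rewrite ler_eXn2l ?ltr1n.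
Qed.

Definition pseudo_orbit (delta : R) (xi : int -> nat -> E) : Prop :=
  (forall t, X (xi t)) /\ (forall t, d (fhat (xi t)) (xi (t + 1)) < delta).

(** Jumps accumulate boundedly over n steps by uniform continuity of the shift;
    this turns a pseudo-orbit of f into one of f^N. *)
Lemma pseudo_orbit_iter n (e : R) : 0 < e -> exists2 delta : R, 0 < delta &
  forall xi, pseudo_orbit delta xi -> forall m t, (m <= n)%N ->
    d (iter m fhat (xi t)) (xi (t + m%:Z)) < e.
Proof.
have [Bd hBd] := inverse_limit_bounded f cL.
elim: n e => [|n IH] e e0.
  exists 1 => // xi [Xxi _] [|m] t // _.
  by rewrite addr0 /= inverse_limit_inv_distxx //; apply: Xxi.
have e20 : 0 < e / 2 by rewrite divr_gt0.
have [r r0 hr] := shift_uniform_continuous e20.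
have [d1 d10 hd1] := IH r r0.
exists (Num.min d1 (e / 2)); first by rewrite lt_min d10.
move=> xi [Xxi hxi] [|m] t mn; first by rewrite addr0 /= inverse_limit_inv_distxx //; apply: Xxi.
have h1 : pseudo_orbit d1 xi.
  by split=> // s; have := hxi s; rewrite lt_min => /andP[].
have Xm : X (iter m fhat (xi t)) by apply: (iter_shift_inverse_limit fL _ (Xxi _)).
have h2 := hr _ _ Xm (Xxi _) (hd1 _ h1 m t mn).
have h3 : d (fhat (xi (t + m%:Z))) (xi (t + m.+1%:Z)) < e / 2.
  have -> : t + m.+1%:Z = t + m%:Z + 1 by lia.
  by have := hxi (t + m%:Z); rewrite lt_min => /andP[].
have := ltrD h2 h3; rewrite -splitr; apply: le_lt_trans.
apply: inv_dist_triangle.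
- exact: hBd (shift_inverse_limit fL Xm).
- exact: hBd (shift_inverse_limit fL (Xxi _)).
- exact: hBd (Xxi _).
Qed.

Lemma orbit_iter (z : int -> E) : (forall t, f (z t) = z (t + 1)) ->
  forall n t, iter n f (z t) = z (t + n%:Z).
Proof.
move=> hz n t; elim: n => [|n IH]; first by rewrite addr0.
rewrite iterS IH hz; congr z; lia.
Qed.

(** A g-orbit z within rho1 of xi is compared with t |-> f (z (t - 1)), which is
    again a g-orbit since f commutes with g, and lies within rho0 of xi.
    Uniqueness at scale rho0 identifies the two, so z is an orbit of f. *)
Lemma orbit_shadowing : exists2 rho0 : R, 0 < rho0 &
  forall rho : R, 0 < rho <= rho0 -> exists2 delta : R, 0 < delta &
  forall xi, pseudo_orbit delta xi -> uniquely_shadowed f 1 rho xi.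
Proof.
have [Bd hBd] := inverse_limit_bounded f cL.
have [N [rho0 rho00 hrho0]] := hyperbolic_iterate_shadowing.
exists rho0 => // rho /andP[rhogt rhole].
have rho20 : 0 < rho0 / 2 by rewrite divr_gt0.
have [r1 r10 hr1] := compact_uniform_continuous cL fc rho20.
pose rho1 := Num.min rho (r1 / 2).
have rho10 : 0 < rho1 by rewrite lt_min rhogt divr_gt0.
have rho1le : rho1 <= rho by rewrite ge_min lexx.
have rho1r : rho1 < r1.
  by apply: (@le_lt_trans _ _ (r1 / 2)); [rewrite ge_min lexx orbT | lra].
have rho1in : 0 < rho1 <= rho0 by rewrite rho10 /= (le_trans rho1le).
have rho0in : 0 < rho0 <= rho0 by rewrite rho00 lexx.
have [d1 d10 hd1] := hrho0 rho1 rho1in.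
have [d0 d00 hd0] := hrho0 rho0 rho0in.
have dm : 0 < Num.min d0 d1 by rewrite lt_min d00.
have [dl dl0 hdl] := pseudo_orbit_iter N dm.
exists (Num.min dl (rho0 / 2)); first by rewrite lt_min dl0.
move=> xi [Xxi hxi].
have hN t : d (iter N fhat (xi t)) (xi (t + N%:Z)) < Num.min d0 d1.
  apply: hdl => //; split => // s.
  by have := hxi s; rewrite lt_min => /andP[].
have [_ uniq0] : uniquely_shadowed (iter N f) N rho0 xi.
  by apply: hd0 => // t; have := hN t; rewrite lt_min => /andP[].
have [[z [zxi zN]] _] : uniquely_shadowed (iter N f) N rho1 xi.
  by apply: hd1 => // t; have := hN t; rewrite lt_min => /andP[].
split; last first.
  move=> w w' [wxi ow] [w'xi ow']; apply: uniq0; split=> t.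
  - exact: le_trans (wxi t) rhole.
  - exact: orbit_iter.
  - exact: le_trans (w'xi t) rhole.
  - exact: orbit_iter.
exists z; split=> [t|t]; first exact: le_trans (zxi t) rho1le.
pose z' t := f (z (t - 1)).
have zz' : z =1 z'.
  apply: uniq0; split => // s.
  - by apply: le_trans (zxi s) _; apply: le_trans rhole.
  - have Ls : L (xi (s - 1) 0%N) by case: (Xxi (s - 1) 0%N).
    have h1 : `|f (xi (s - 1) 0%N) - f (z (s - 1))| < rho0 / 2.
      by apply: hr1 => //; rewrite distrC; apply: le_lt_trans rho1r.
    have h2 : `|f (xi (s - 1) 0%N) - xi s 0%N| < rho0 / 2.
      have := hxi (s - 1); rewrite subrK lt_min => /andP[_]; apply: le_lt_trans.
      have Xf : X (fhat (xi (s - 1))) by apply: (shift_inverse_limit fL (Xxi _)).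
      have := inv_dist_coord 0 (hBd _ Xf) (hBd _ (Xxi s)).
      by rewrite expr0 mul1r.
    apply: le_trans (ler_distD (f (xi (s - 1) 0%N)) _ _) _.
    by rewrite distrC; lra.
  - rewrite /z' -iterSr iterS zN; congr (f (z _)); lia.
by rewrite [RHS]zz' /z' addrK.
Qed.

Lemma ziter_unshift_coord x i : ziter fhat unshift (- i%:Z) x 0%N = x i.
Proof.
case: i => [|k] //; rewrite -NegzE /=.
elim: k x => [|k IH] x //.
by rewrite -[x k.+2]/(unshift x k.+1) -IH -[RHS]/(iter k.+1 unshift (unshift x) 0%N) -iterSr.
Qed.

Lemma ziter_pseudo_orbit (delta : R) x : 0 < delta -> X x ->
  pseudo_orbit delta (fun t => ziter fhat unshift t x).
Proof.
move=> delta0 Xx.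
have Xz t : X (ziter fhat unshift t x).
  exact: (ziter_stable (X := X) (shift_inverse_limit fL) (@unshift_inverse_limit _ _ _ _)).
split=> // t; rewrite (ziterS (X := X)) ?inverse_limit_inv_distxx //.
  exact: unshift_inverse_limit.
exact: unshiftK.
Qed.

Lemma shift_expansive : expansive d X fhat unshift.
Proof.
have [Bd hBd] := inverse_limit_bounded f cL.
have [rho0 rho00 hrho0] := orbit_shadowing.
have rho0in : 0 < rho0 <= rho0 by rewrite rho00 lexx.
have [dl dl0 hdl] := hrho0 rho0 rho0in.
exists rho0 => // x y Xx Xy hxy.
have [_ uniq] := hdl _ (ziter_pseudo_orbit dl0 Xx).
have Xz u t : X u -> X (ziter fhat unshift t u).
  exact: (ziter_stable (X := X) (shift_inverse_limit fL) (@unshift_inverse_limit _ _ _ _)).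
have oz u t : X u ->
    f (ziter fhat unshift t u 0%N) = ziter fhat unshift (t + 1) u 0%N.
  move=> Xu; rewrite -(ziterS (X := X)) //; first exact: unshift_inverse_limit.
  exact: unshiftK.
have e := uniq (fun t => ziter fhat unshift t x 0%N) (fun t => ziter fhat unshift t y 0%N).
apply/funext => i; rewrite -(ziter_unshift_coord x) -(ziter_unshift_coord y).
apply: e; split=> t.
- by rewrite subrr normr0 ltW.
- exact: oz.
- rewrite distrC; have := inv_dist_coord 0 (hBd _ (Xz _ t Xx)) (hBd _ (Xz _ t Xy)).
  by rewrite expr0 mul1r => h; apply: le_trans h _; apply: ltW; apply: hxy.
- exact: oz.
Qed.

Lemma shift_homeomorphism : homeomorphism d X fhat unshift.
Proof.
split.
- exact: shift_inverse_limit.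
- exact: unshift_inverse_limit.
- by move=> x Xx; split => //; apply: unshiftK.
- move=> x Xx e e0; have [r r0 hr] := shift_uniform_continuous e0.
  by exists r => // y Xy; apply: hr.
- move=> x Xx e e0; have [r r0 hr] := unshift_uniform_continuous e0.
  by exists r => // y Xy; apply: hr.
Qed.

Section Isolated.
Context (V : set E).
Hypotheses (oV : open V) (LV : L `<=` V)
  (LE : L = \bigcap_(n in [set: int]) fpow f n V).

(** Every z t lies in all images and preimages of V: it is the image of the
    earlier points of the orbit, and its own images are the later ones. *)
Lemma full_orbit_isolated (z : int -> E) : (forall t, f (z t) = z (t + 1)) ->
  (forall t, V (z t)) -> forall t, L (z t).
Proof.
move=> hz Vz t; rewrite LE => -[] n _ /=.
  exists (z (t - n%:Z)) => //; rewrite orbit_iter //; congr z; lia.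
by rewrite -iterS orbit_iter.
Qed.

(** The point at time t of the shadowing orbit in the inverse limit is the
    prehistory of z t along the orbit z itself.  Its i-th entry z (t - i) is close
    to the base point of xi (t - i), which in turn is close to the i-th entry of
    xi t since the i-th image of xi (t - i) is close to xi t. *)
Lemma inverse_limit_shadowing (e : R) : 0 < e -> exists2 delta : R, 0 < delta &
  forall xi, pseudo_orbit delta xi -> exists zeta : int -> nat -> E,
  [/\ forall t, X (zeta t), forall t, fhat (zeta t) = zeta (t + 1),
      forall t, d (zeta t) (xi t) < e
    & forall q : int, (forall t, xi (t + q) = xi t) ->
        forall t, zeta (t + q) = zeta t].
Proof.
move=> e0; have [Bd hBd] := inverse_limit_bounded f cL.
have [j [s s0 hs]] := inv_dist_small E Bd e0.
have [rho0 rho00 hrho0] := orbit_shadowing.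
have [r1 r10 hr1] := compact_open_margin cL oV LV.
pose rho := Num.min rho0 (Num.min (r1 / 2) (s / 2)).
have rho_gt0 : 0 < rho by rewrite !lt_min rho00 !divr_gt0.
have rhoin : 0 < rho <= rho0 by rewrite rho_gt0 ge_min lexx.
have rhor1 : rho < r1.
  apply: (@le_lt_trans _ _ (r1 / 2)); last by lra.
  by rewrite !ge_min lexx orbT.
have rhos : rho <= s / 2 by rewrite !ge_min lexx !orbT.
have [d1 d10 hd1] := hrho0 rho rhoin.
have s2j : 0 < s / 2 / 2 ^+ j by rewrite !divr_gt0 ?exprn_gt0.
have [d2 d20 hd2] := pseudo_orbit_iter j s2j.
exists (Num.min d1 d2); first by rewrite lt_min d10.
move=> xi [Xxi hxi].
have p1 : pseudo_orbit d1 xi.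
  by split=> // t; have := hxi t; rewrite lt_min => /andP[].
have p2 : pseudo_orbit d2 xi.
  by split=> // t; have := hxi t; rewrite lt_min => /andP[].
have [[z [zxi oz]] uniq] := hd1 _ p1.
have Lxi t : L (xi t 0%N) by case: (Xxi t 0%N).
have Lz t : L (z t).
  apply: full_orbit_isolated => // u; apply: hr1 (Lxi u) _.
  by rewrite distrC; apply: le_lt_trans rhor1.
pose zeta (t : int) (i : nat) := z (t - i%:Z).
have Xzeta t : X (zeta t).
  move=> i; split; first exact: Lz.
  rewrite /zeta oz; congr z; lia.
exists zeta; split => //.
- move=> t; apply/funext => -[|i] /=; rewrite /zeta.
    by rewrite oz subr0; congr z; lia.
  congr z; lia.
- move=> t; apply: hs; [exact: hBd (Xzeta t) | exact: hBd (Xxi t) | move=> i ij].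
  rewrite /zeta; apply: le_trans (ler_distD (xi (t - i%:Z) 0%N) _ _) _.
  have h1 := zxi (t - i%:Z).
  have h2 : `|xi (t - i%:Z) 0%N - xi t i| <= s / 2.
    have h := hd2 xi p2 i (t - i%:Z) (ltnW ij); rewrite subrK in h.
    have Xi : X (iter i fhat (xi (t - i%:Z))) by apply: (iter_shift_inverse_limit fL _ (Xxi _)).
    have := inv_dist_coord i (hBd _ Xi) (hBd _ (Xxi t)).
    have := iter_shift_ge f i (xi (t - i%:Z)) 0; rewrite addn0 => ->.
    move=> h3; apply: le_trans h3 _.
    apply: le_trans (_ : 2 ^+ i * (s / 2 / 2 ^+ j) <= _).
      by rewrite ler_wpM2l ?exprn_ge0 // ltW.
    rewrite mulrCA ler_piMr ?divr_ge0 ?ltW // ltr_pdivrMr ?exprn_gt0 // mul1r.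
    by rewrite ltr_eXn2l ?ltr1n.
  lra.
- move=> q hq t; apply/funext => i; rewrite /zeta.
  have e1 : z =1 (fun u => z (u + q)).
    apply: uniq; split=> // u.
      by rewrite -hq; apply: zxi.
    by rewrite oz; congr z; lia.
  rewrite [RHS]e1; congr z; lia.
Qed.

End Isolated.
End HyperbolicShadowing.

(** * Mixing and specification *)

Section Mixing.
Context (R : realType) (E : normedModType R) (f : E -> E) (L : set E).
Hypotheses (cL : compact L) (fL : f @` L = L)
  (fc : forall x, L x -> {for x, continuous f}) (mixL : mixing_on f L).

Let X := inverse_limit f L.
Let fhat := limit_shift f.
Let d := @inv_dist R E.

(** Mixing gives a time for each pair of balls; by compactness of L x L finitely
    many pairs suffice. *)
Lemma uniform_mixing (r : R) : 0 < r -> exists N : nat, forall n x y, (N <= n)%N ->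
  L x -> L y -> exists p, [/\ L p, `|x - p| < r & `|y - iter n f p| < r].
Proof.
move=> r0; have r20 : 0 < r / 2 by rewrite divr_gt0.
pose P n (xy : E * E) :=
  exists p, [/\ L p, `|xy.1 - p| < r & `|xy.2 - iter n f p| < r].
have /compact_near_coveringP cLL := compact_setX cL cL.
have [N _ hN] : \forall n \near \oo, L `*` L `<=` P n.
  apply: cLL => -[x y] [/= Lx Ly].
  have [||N hN] := mixL (ball_open x (r / 2)) (ball_open y (r / 2)).
  - by exists x; split => //; apply: ballxx.
  - by exists y; split => //; apply: ballxx.
  exists (ball x (r / 2) `*` ball y (r / 2), [set n | (N <= n)%N]).
    split => /=; last by exists N.
    by exists (ball x (r / 2), ball y (r / 2)) => //; split; apply: nbhsx_ballx.
  move=> [[x' y'] n] [[/= xx' yy'] Nn].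
  have [_ [[p [xp Lp] <-] [yp _]]] := hN n Nn.
  rewrite -!ball_normE /= in xx' yy' xp yp.
  exists p; split => //=.
    apply: le_lt_trans (ler_distD x _ _) _; rewrite distrC; lra.
  apply: le_lt_trans (ler_distD y _ _) _; rewrite distrC; lra.
by exists N => n x y Nn Lx Ly; apply: (hN n Nn (x, y)).
Qed.

Lemma prehistory_exists p : L p -> exists2 x, X x & x 0%N = p.
Proof.
move=> Lp.
have h q : exists p', L q -> L p' /\ f p' = q.
  case: (pselect (L q)) => [|nLq]; last by exists q.
  by rewrite -{1}fL => -[p' Lp' e]; exists p'.
have [g hg] := choice h.
have Lg i : L (iter i g p) by elim: i => //= i IH; case: (hg _ IH).
exists (fun i => iter i g p) => // i; split => //.
by rewrite iterS; case: (hg _ (Lg i)).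
Qed.

Lemma inverse_limit_iter x i k : X x -> iter k f (x (i + k)%N) = x i.
Proof.
move=> Xx; elim: k => [|k IH]; first by rewrite addn0.
by rewrite iterSr addnS; have [_ ->] := Xx (i + k)%N.
Qed.

Lemma iter_uniform_continuous j (s : R) : 0 < s -> exists2 r : R, 0 < r &
  forall k p q, (k <= j)%N -> L p -> L q -> `|p - q| < r ->
    `|iter k f p - iter k f q| < s.
Proof.
have Lit k p : L p -> L (iter k f p).
  by move=> Lp; elim: k => //= k IH; rewrite -fL; exists (iter k f p).
elim: j s => [|j IH] s s0; first by exists s => // -[|k] p q.
have [r1 r10 h1] := compact_uniform_continuous cL fc s0.
have [r2 r20 h2] := IH r1 r10.
exists (Num.min s r2); first by rewrite lt_min s0.
move=> [|k] p q kj Lp Lq; rewrite lt_min => /andP[hs hr] //=.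
by apply: h1; [exact: Lit | exact: h2].
Qed.

(** Two prehistories are close as soon as their entries at a large depth j are,
    since f^(j - i) takes entry j to entry i.  So it is enough to mix in L the
    entries at depth j, and to choose any prehistory of the connecting point. *)
Lemma inverse_limit_mixing (e : R) : 0 < e -> exists N : nat, forall n x y,
  (N <= n)%N -> X x -> X y ->
  exists z, [/\ X z, d x z < e & d (iter n fhat z) y < e].
Proof.
move=> e0; have [Bd hBd] := inverse_limit_bounded f cL.
have [j [s s0 hs]] := inv_dist_small E Bd e0.
have [r r0 hr] := iter_uniform_continuous j s0.
have [N hN] := uniform_mixing r0.
have close x y : X x -> X y -> `|x j - y j| < r -> d x y < e.
  move=> Xx Xy xy; apply: hs; [exact: hBd Xx | exact: hBd Xy | move=> i ij].
  have e1 : (i + (j - i))%N = j by rewrite subnKC // ltnW.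
  have := inverse_limit_iter i (j - i) Xx; have := inverse_limit_iter i (j - i) Xy.
  rewrite e1 => <- <-; apply/ltW/hr => //; first exact: leq_subr.
    by case: (Xx j).
  by case: (Xy j).
exists N => n x y Nn Xx Xy.
have [p [Lp xp yp]] := hN n _ _ Nn (proj1 (Xx j)) (proj1 (Xy j)).
have [w Xw w0] := prehistory_exists Lp.
have XI m u : X u -> X (iter m fhat u) by apply: iter_shift_inverse_limit.
have at_j u : iter j fhat u j = u 0%N.
  by have := iter_shift_ge f j u 0; rewrite addn0.
exists (iter j fhat w); split; first exact: XI.
  by apply: close => //; [exact: XI | rewrite at_j w0].
apply: close => //; first by apply/XI/XI.
by rewrite -iterD addnC iterD at_j iter_shift0 w0 distrC.
Qed.

End Mixing.

Section PeriodicPseudoOrbit.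
Context (R : realType) (S : Type) (d : S -> S -> R) (X : set S) (T T' : S -> S).
Context (N : nat) (delta : R).
Hypotheses (XT : forall x, X x -> X (T x)) (delta0 : 0 < delta)
  (dxx : forall x, X x -> d x x = 0)
  (connect : forall n x y, (N <= n)%N -> X x -> X y ->
    exists z, [/\ X z, d x z < delta & d (iter n T z) y < delta]).

Let XiterT n x : X x -> X (iter n T x).
Proof. by move=> Xx; elim: n => //= n; apply: XT. Qed.

(** A connecting segment over the open gap ]b, a[, from the image of the last
    point at time b to a prescribed point y at time a. *)
Lemma extend_pseudo_orbit (xi : int -> S) (b a : int) (y : S) :
  X (xi b) -> X y -> b + N.+1%:Z < a ->
  exists eta : int -> S, [/\ forall t, t <= b -> eta t = xi t,
    forall t, b < t < a -> X (eta t),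
    forall t, b <= t -> t + 1 < a -> d (T (eta t)) (eta (t + 1)) < delta
    & d (T (eta (a - 1))) y < delta].
Proof.
move=> Xb Xy ba.
pose n := absz (a - b - 1)%R.
have nE : n%:Z = a - b - 1 by rewrite /n; lia.
have Nn : (N <= n)%N by lia.
have [z [Xz xz zy]] := connect Nn (XT Xb) Xy.
exists (fun t => if t <= b then xi t else iter (absz (t - b - 1)%R) T z); split.
- by move=> t ->.
- by move=> t /andP[bt ta]; rewrite leNgt bt; apply: XiterT.
- move=> t bt ta.
  have -> : (t + 1 <= b) = false by lia.
  case: (lerP t b) => tb.
    have -> : t = b by lia.
    by have -> : absz (b + 1 - b - 1)%R = 0%N by lia.
  have -> : absz (t + 1 - b - 1)%R = (absz (t - b - 1)%R).+1 by lia.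
  by rewrite iterS dxx //; apply/XT/XiterT.
- have -> : (a - 1 <= b) = false by lia.
  by rewrite -iterS; have -> : (absz (a - 1 - b - 1)%R).+1 = n by lia.
Qed.

(** By induction on the number of blocks; the order of the endpoints of the
    intervals is carried along, since spacing only compares neighbours. *)
Lemma specification_pseudo_orbit (s : specification X T T') j :
  spaced N.+1 s -> (j < spec_m s)%N ->
  exists xi : int -> S,
  [/\ forall i, (i <= j)%N -> spec_b s i <= spec_b s j,
      forall i, (i <= j)%N -> spec_a s 0 <= spec_a s i,
      forall t, spec_a s 0 <= t <= spec_b s j -> X (xi t),
      forall t, spec_a s 0 <= t < spec_b s j -> d (T (xi t)) (xi (t + 1)) < delta
    & forall i t, (i <= j)%N -> spec_a s i <= t <= spec_b s i -> xi t = spec_P s t].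
Proof.
move=> sp; elim: j => [|j IH] jm.
  exists (spec_P s); split.
  - by case.
  - by case.
  - by move=> t ht; apply: (spec_PX jm).
  - move=> t ht.
    have ht1 : spec_a s 0 <= t <= spec_b s 0 by lia.
    have ht2 : spec_a s 0 <= t + 1 <= spec_b s 0 by lia.
    have := spec_orbit jm ht1 ht2; have -> : t + 1 - t = 1 by lia.
    by move=> /= ->; rewrite dxx //; apply: (spec_PX jm ht2).
  - by case.
have jm' := ltnW jm.
have [xi [hb ha hX hd hP]] := IH jm'.
have := sp j jm; set b := spec_b s j; set a := spec_a s j.+1 => ba.
have ab' : a <= spec_b s j.+1 by apply: spec_ab.
have ab := spec_ab jm'.
have a0b : spec_a s 0 <= b by have := ha j (leqnn _); lia.
have Xb : X (xi b) by apply: hX; rewrite a0b /=.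
have Xa : X (spec_P s a) by apply: (spec_PX jm); rewrite lexx.
have [eta [eb eX ed ea]] := extend_pseudo_orbit Xb Xa ba.
exists (fun t => if t < a then eta t else spec_P s t); split.
- move=> i; rewrite leq_eqVlt => /orP[/eqP -> //|ij].
  by have := hb i ij; rewrite -/b; lia.
- move=> i; rewrite leq_eqVlt => /orP[/eqP ->|ij]; last exact: ha.
  by rewrite -/a; lia.
- move=> t ht; case: (ltrP t a) => ta.
    case: (lerP t b) => tb; first by rewrite eb //; apply: hX; lia.
    by apply: eX; rewrite tb.
  by apply: (spec_PX jm); rewrite -/a; lia.
- move=> t ht; case: (ltrP t a) => ta.
    case: (ltrP (t + 1) a) => ta1.
      case: (ltrP t b) => tb; last exact: ed.
      by rewrite !eb; [apply: hd| |]; lia.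
    have -> : t = a - 1 by lia.
    by rewrite subrK.
  have -> : (t + 1 < a) = false by lia.
  have ht1 : spec_a s j.+1 <= t <= spec_b s j.+1 by rewrite -/a; lia.
  have ht2 : spec_a s j.+1 <= t + 1 <= spec_b s j.+1 by rewrite -/a; lia.
  have := spec_orbit jm ht1 ht2; have -> : t + 1 - t = 1 by lia.
  by move=> /= ->; rewrite dxx //; apply: (spec_PX jm ht2).
- move=> i t; rewrite leq_eqVlt => /orP[/eqP ->|ij] ht.
    by have -> : (t < a) = false by rewrite /a; lia.
  have hbi := hb i ij.
  have -> : t < a by rewrite /b in ba; lia.
  by rewrite eb; [apply: (hP i) | rewrite /b; lia].
Qed.

(** One more connecting segment leads from the last block back to the start of
    the first one at time a + q, and the window [a, a + q[ is repeated. *)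
Lemma specification_periodic_pseudo_orbit (s : specification X T T') (q : nat) :
  spaced N.+1 s -> N.+2%:Z + spec_length s <= q%:Z ->
  exists xi : int -> S,
  [/\ forall t, X (xi t), forall t, d (T (xi t)) (xi (t + 1)) < delta,
      forall t, xi (t + q%:Z) = xi t
    & forall t, spec_times s t -> xi t = spec_P s t].
Proof.
move=> sp hq; have m0 := spec_m_gt0 s.
have jm : ((spec_m s).-1 < spec_m s)%N by rewrite prednK.
have [xi [hb ha hX hd hP]] := specification_pseudo_orbit sp jm.
move: hq; rewrite /spec_length.
set a := spec_a s 0 in ha hX hd *; set b := spec_b s (spec_m s).-1 in hb hX hd * => hq.
have ab : a <= b by have := ha _ (leqnn _); have := spec_ab jm; rewrite -/b; lia.
have Xb : X (xi b) by apply: hX; rewrite ab /=.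
have Xa : X (xi a) by apply: hX; rewrite lexx.
have baq : b + N.+1%:Z < a + q%:Z by lia.
have [eta [eb eX ed ea]] := extend_pseudo_orbit Xb Xa baq.
have q0 : 0 < q%:Z by lia.
(* The representative of t modulo q in the window [a, a + q[. *)
pose u (t : int) : int := a + ((t - a) %% q%:Z)%Z.
have u_range t : a <= u t < a + q%:Z.
  by rewrite /u; have := modz_ge0 (t - a) (lt0r_neq0 q0); have := ltz_pmod (t - a) q0; lia.
have u_id t : a <= t < a + q%:Z -> u t = t.
  by move=> ht; rewrite /u modz_small; lia.
have u_period t (k : int) : u (t + k * q%:Z) = u t.
  by rewrite /u addrAC [t - a + _]addrC modzMDl.
have Xeta t : a <= t < a + q%:Z -> X (eta t).
  move=> ht; case: (lerP t b) => tb; first by rewrite eb //; apply: hX; lia.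
  by apply: eX; lia.
have u_split t : exists k : int, t = u t + k * q%:Z.
  exists ((t - a) %/ q%:Z)%Z; rewrite /u; have := divz_eq (t - a) q%:Z; lia.
have dn t : a <= t -> t + 1 < a + q%:Z -> d (T (eta t)) (eta (t + 1)) < delta.
  move=> t1 t2; case: (ltrP t b) => tb; last exact: ed.
  by rewrite !eb; [apply: hd| |]; lia.
exists (fun t => eta (u t)); split.
- by move=> t; apply: Xeta.
- move=> t; have [k e] := u_split t; have ut := u_range t.
  have -> : u (t + 1) = u (u t + 1) by rewrite {1}e addrAC u_period.
  case: (ltrP (u t + 1) (a + q%:Z)) => h.
    by rewrite [u (_ + 1)]u_id; [apply: dn|]; lia.
  have -> : u (u t + 1) = a.
    have -> : u t + 1 = a + 1 * q%:Z by lia.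
    by rewrite u_period u_id // lexx /=; lia.
  have -> : u t = a + q%:Z - 1 by lia.
  by rewrite (eb a).
- by move=> t; have := u_period t 1; rewrite mul1r => ->.
- move=> t [i im ht].
  have ij : (i <= (spec_m s).-1)%N by rewrite -ltnS prednK.
  have h1 := hb i ij; have h2 := ha i ij.
  have tb : t <= b by lia.
  rewrite u_id; last by lia.
  by rewrite eb //; apply: (hP i).
Qed.

End PeriodicPseudoOrbit.

(** A connecting segment needs a gap b + N + 1 < a.  The condition q >= M + L(S)
    gives only a weak inequality across the end of the period, whence M = N + 2. *)
Lemma hyperbolic_mixing_specification (R : realType) (E : normedModType R)
    (F : frame E) (f : E -> E) (L : set E) :
  mixing_basic_set f L -> hyperbolic f L ->
  specification_property (inv_dist E) (inverse_limit f L) (limit_shift f)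
    (limit_unshift E).
Proof.
move=> [[cL fL [V [oV LV LE]] _] mixL] hypf e e0.
have fc := smooth_near_continuous hypf.1.
have [delta delta0 hdelta] := inverse_limit_shadowing F cL fL hypf oV LV LE e0.
have [N hN] := inverse_limit_mixing cL fL fc mixL delta0.
have XT := shift_inverse_limit fL.
have XT' := @unshift_inverse_limit _ _ f L.
have T'K := @unshiftK _ _ f L.
have dxx := inverse_limit_inv_distxx (f := f) cL.
exists N.+2 => s sp.
have sp' : spaced N.+1 s by move=> i im; have := sp i im; lia.
have per (q : nat) : N.+2%:Z + spec_length s <= q%:Z ->
    exists x, [/\ inverse_limit f L x, iter q (limit_shift f) x = x
      & shadowed (inv_dist E) e s x].
  move=> hq.
  have [xi [Xxi dxi pxi Pxi]] :=
    specification_periodic_pseudo_orbit XT delta0 dxx hN sp' hq.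
  have [zeta [Xz oz dz pz]] := hdelta xi (conj Xxi dxi).
  have it t : ziter (limit_shift f) (limit_unshift E) t (zeta 0) = zeta t.
    exact: (orbit_ziter (X := inverse_limit f L)).
  exists (zeta 0); split => //.
    by have := it q%:Z => /= ->; have := pz q%:Z pxi 0; rewrite add0r.
  by move=> n hn; rewrite it -Pxi.
split; last exact: per.
have [x [Xx _ sx]] := per (absz (N.+2%:Z + spec_length s)%R) (lez_abs _).
by exists x.
Qed.

Definition line_frame (R : realType) : frame R^o.
Proof.
exists 1%N (fun=> 1) (fun=> idfun) => //= v.
by rewrite big_ord1 /GRing.scale /= mulr1.
Qed.

Definition plane_frame (R : realType) : frame (R^o * R^o)%type.
Proof.
pose fstL : {linear (R^o * R^o)%type -> R^o} := fst.
pose sndL : {linear (R^o * R^o)%type -> R^o} := snd.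
exists 2 (fun i : 'I_2 => if i == ord0 then (1, 0) else (0, 1))
  (fun i : 'I_2 => if i == ord0 then fstL else sndL).
  by move=> i [x y]; rewrite prod_normE; case: ifP => _ /=; rewrite le_max lexx ?orbT.
move=> [x y]; rewrite big_ord_recl big_ord1 /=.
have s1 (a : R^o) : a *: (1 : R^o) = a by rewrite /GRing.scale /= mulr1.
transitivity ((x : R^o) *: (1 : R^o) + (y : R^o) *: (0 : R^o),
              (x : R^o) *: (0 : R^o) + (y : R^o) *: (1 : R^o)) => //.
by rewrite !s1 !scaler0 addr0 add0r.
Qed.

Theorem theorem3 (R : realType) (e : economic_model R)
    (Lambda : set (state_space e)) :
  Lambda `<=` model_domain e ->
  mixing_basic_set (model_map e) Lambda ->
  hyperbolic (model_map e) Lambda ->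
  let d := inv_dist (state_space e) in
  let Lambda_hat := inverse_limit (model_map e) Lambda in
  let f_hat := limit_shift (model_map e) in
  let f_hat_inv := limit_unshift (state_space e) in
  [/\ homeomorphism d Lambda_hat f_hat f_hat_inv,
      expansive d Lambda_hat f_hat f_hat_inv
    & specification_property d Lambda_hat f_hat f_hat_inv].
Proof.
move=> _ mb hyp /=.
have F : frame (state_space e).
  by case: e {Lambda mb hyp} => *; [exact: line_frame | exact: plane_frame
    | exact: line_frame | exact: line_frame | exact: plane_frame].
have [[cL fL _ _] _] := mb.
split.
- exact: (shift_homeomorphism cL fL hyp).
- exact: (shift_expansive F cL fL hyp).
- exact: (hyperbolic_mixing_specification F mb hyp).
Qed.
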